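(* For every integer $n\ge 2$, the number of distinct interval posets $P(\pi)$, where $\pi$ ranges over the block-wise simple permutations in $\mathcal{S}_n$, is equal to the number of ways to place non-crossing diagonals in a convex $(n+1)$-gon (with labelled vertices) such that no triangles or quadrilaterals are present, i.e. the number of sets (possibly empty) of pairwise non-crossing diagonals of the $(n+1)$-gon such that none of the polygonal regions into which they divide the $(n+1)$-gon is a triangle or a quadrilateral.
   Context: $\mathcal{S}_n$ is the set of permutations of $\{1,\dots,n\}$, written in one-line notation. An interval of $\pi=a_1\cdots a_n\in\mathcal{S}_n$ is a non-empty contiguous sequence of entries $a_ia_{i+1}\cdots a_{i+k}$ whose values form a set of consecutive integers; an interval is identified with its set of values $[a,b]=\{a,a+1,\dots,b\}$. The whole permutation and the single entries are the trivial intervals; all others are proper. A permutation is simple if it has no proper intervals. The interval poset $P(\pi)$ of $\pi\in\mathcal{S}_n$ is the poset whose elements are the (non-empty) intervals of $\pi$, viewed as sets of values $[a,b]\subseteq\{1,\dots,n\}$, ordered by inclusion. Two interval posets are the same if they consist of the same sets of values (equivalently, they are counted as plane posets in which the children of each node are ordered from left to right by increasing minimum). Inflation: for $\sigma\in\mathcal{S}_k$ and $\alpha_i\in\mathcal{S}_{n_i}$ ($n_i\ge1$, $1\le i\le k$), $\sigma[\alpha_1,\dots,\alpha_k]\in\mathcal{S}_{n_1+\cdots+n_k}$ is the permutation obtained by replacing the $i$-th entry of $\sigma$, for each $i$, by a block of $n_i$ consecutive positions and consecutive values that is order-isomorphic to $\alpha_i$, the blocks being in the same relative order (in values) as the entries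 of $\sigma$. Example: $2413[213,21,132,1]=546\,98\,132\,7$. Block-wise simple permutations are defined recursively: (1) the permutation $1\in\mathcal{S}_1$ is block-wise simple; (2) $\pi\in\mathcal{S}_n$ is block-wise simple if there are a simple permutation $\sigma\in\mathcal{S}_k$ with $k\ge 4$ and block-wise simple permutations $\alpha_1,\dots,\alpha_k$ such that $\pi=\sigma[\alpha_1,\dots,\alpha_k]$. No other permutations are block-wise simple. A diagonal of a convex polygon is a segment joining two non-adjacent vertices; two diagonals are non-crossing if they do not meet in the interior of the polygon. *)

(* Defs.v *)
From mathcomp Require Import all_boot all_order all_fingroup all_algebra.
From mathcomp Require Import all_classical all_reals.
From mathcomp Require Import topology normedtype.
Import Order.TTheory GRing.Theory Num.Theory.
Import numFieldNormedType.Exports.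

Set Implicit Arguments.
Unset Strict Implicit.
Unset Printing Implicit Defensive.

Local Open Scope classical_set_scope.
Local Open Scope ring_scope.

(* Permutations of {1..n} are rendered as 'S_n, acting on {0..n-1}:           *)
(* positions and values are both shifted down by one.                         *)

Definition segment_ord (n : nat) (a b : 'I_n) : {set 'I_n} :=
  [set x : 'I_n | (a <= x <= b)%N]%SET.

Definition perm_interval (n : nat) (pi : 'S_n) (A : {set 'I_n}) : bool :=
  [&& A != finset.set0,
      [exists i, exists j, A == [set pi x | x in segment_ord i j]%SET]
    & [exists a, exists b, A == segment_ord a b]].

(* The order is inclusion, so the poset is determined by its elements.        *)
Definition interval_poset (n : nat) (pi : 'S_n) : {set {set 'I_n}} :=
  [set A : {set 'I_n} | perm_interval pi A]%SET.

Definition proper_interval (n : nat) (pi : 'S_n) (A : {set 'I_n}) : bool :=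
  [&& perm_interval pi A, A != [set: 'I_n]%SET & #|A| != 1%N].

Definition simple_perm (n : nat) (pi : 'S_n) : bool :=
  [forall A : {set 'I_n}, ~~ proper_interval pi A].

Definition one_line (n : nat) (pi : 'S_n) : seq nat :=
  [seq nat_of_ord (pi i) | i <- enum 'I_n].

(* One-line notation of sigma[alpha_1, ..., alpha_k]: the values of the i-th  *)
(* block start above those of all the blocks j with sigma j < sigma i.        *)
Definition inflation (k : nat) (sigma : 'S_k) (m : 'I_k -> nat)
    (alpha : forall i : 'I_k, 'S_(m i)) : seq nat :=
  flatten [seq [seq ((\sum_(j < k | (sigma j < sigma i)%N) m j) + a)%N
               | a <- one_line (alpha i)]
          | i <- enum 'I_k].

Inductive blockwise_simple : forall n : nat, 'S_n -> Prop :=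
| blockwise_simple_one (pi : 'S_1) : blockwise_simple pi
| blockwise_simple_inflation (n : nat) (pi : 'S_n) (k : nat) (sigma : 'S_k)
    (m : 'I_k -> nat) (alpha : forall i : 'I_k, 'S_(m i)) :
    (4 <= k)%N -> simple_perm sigma ->
    (forall i, (1 <= m i)%N) -> (forall i, blockwise_simple (alpha i)) ->
    one_line pi = inflation sigma alpha ->
    blockwise_simple pi.

Definition blockwise_simple_posets (n : nat) : {set {set {set 'I_n}}} :=
  [set P : {set {set 'I_n}} |
    `[< exists2 pi : 'S_n, blockwise_simple pi & P = interval_poset pi >]]%SET.

(* Twice the signed area of the triangle pqr: positive iff r lies strictly to *)
(* the left of the line directed from p to q.                                 *)
Definition orient (R : realType) (p q r : R * R) : R :=
  (q.1 - p.1) * (r.2 - p.2) - (q.2 - p.2) * (r.1 - p.1).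

(* v lists the vertices counterclockwise; [ordS] is the cyclic successor.     *)
(* Strictness excludes collinear vertices.                                    *)
Definition convex_polygon (R : realType) (m : nat) (v : 'I_m -> R * R) : Prop :=
  forall i j : 'I_m, j != i -> j != ordS i -> 0 < orient (v i) (v (ordS i)) (v j).

Definition polygon_interior (R : realType) (m : nat) (v : 'I_m -> R * R) :
    set (R * R) :=
  [set p | forall i : 'I_m, 0 < orient (v i) (v (ordS i)) p].

(* A diagonal is encoded by its endpoints, the one of smaller index first.    *)
Definition is_diagonal (m : nat) (d : 'I_m * 'I_m) : bool :=
  [&& (d.1 < d.2)%N, d.2 != ordS d.1 & d.1 != ordS d.2].

Definition diagonal_segment (R : realType) (m : nat) (v : 'I_m -> R * R)
    (d : 'I_m * 'I_m) : set (R * R) :=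
  [set p | exists2 t : R, 0 <= t <= 1 & p = (1 - t) *: v d.1 + t *: v d.2].

Definition noncrossing (R : realType) (m : nat) (v : 'I_m -> R * R)
    (d e : 'I_m * 'I_m) : Prop :=
  diagonal_segment v d `&` diagonal_segment v e `&` polygon_interior v = set0.

Definition diagonals_complement (R : realType) (m : nat) (v : 'I_m -> R * R)
    (D : {set 'I_m * 'I_m}) : set (R * R) :=
  polygon_interior v `\` \bigcup_(d in [set` D]) diagonal_segment v d.

(* Regions are taken open, i.e. without their sides.                          *)
Definition is_region (R : realType) (m : nat) (v : 'I_m -> R * R)
    (D : {set 'I_m * 'I_m}) (A : set (R * R)) : Prop :=
  exists2 p, diagonals_complement v D p
           & A = connected_component (diagonals_complement v D) p.

Definition is_convex_gon (R : realType) (k : nat) (A : set (R * R)) : Prop :=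
  exists2 w : 'I_k -> R * R, convex_polygon w & A = polygon_interior w.

Definition noncrossing_diagonals (R : realType) (m : nat) (v : 'I_m -> R * R)
    (D : {set 'I_m * 'I_m}) : Prop :=
  (forall d, d \in D -> is_diagonal d) /\
  (forall d e, d \in D -> e \in D -> d != e -> noncrossing v d e).

Definition no_triangle_quadrilateral (R : realType) (m : nat)
    (v : 'I_m -> R * R) (D : {set 'I_m * 'I_m}) : Prop :=
  forall A, is_region v D A -> ~ is_convex_gon 3 A /\ ~ is_convex_gon 4 A.

Definition diagonal_placements (R : realType) (m : nat) (v : 'I_m -> R * R) :
    {set {set 'I_m * 'I_m}} :=
  [set D : {set 'I_m * 'I_m} |
    `[< noncrossing_diagonals v D /\ no_triangle_quadrilateral v D >]]%SET.

(* Main.v *)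
(* An interval [a, b - 1] of values of a permutation of {0, ..., n - 1} is    *)
(* read as the chord (a, b) of a polygon with vertices 0, ..., n: singletons  *)
(* are sides, the whole permutation is the side (0, n), and overlapping       *)
(* intervals are crossing chords.  When [sigma] is simple of size k >= 4, the *)
(* intervals of an inflation of [sigma] are the whole permutation and the     *)
(* intervals of the blocks, so the chords of a block-wise simple permutation  *)
(* do not cross, and each chord other than a side splits into at least four   *)
(* maximal smaller ones, i.e. the chords bound no triangle or quadrilateral.  *)
(* Conversely such a family of chords is realized by inflating a simple       *)
(* permutation recursively.                                                   *)
(*   On the geometric side, the region of a point p is the set of the points  *)
(* lying on the same strict side as p of all the diagonals and sides.  If the *)
(* region is the interior of a polygon w, mapping a side of the region to a   *)
(* line supporting w at its midpoint is injective, hence w has at least as    *)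
(* many sides as the region.                                                  *)

Require Import Defs.
From mathcomp Require Import all_boot all_order all_fingroup all_algebra.
From mathcomp Require Import all_classical all_reals.
From mathcomp Require Import topology normedtype.
From mathcomp Require Import zify ring lra.

Set Implicit Arguments.
Unset Strict Implicit.
Unset Printing Implicit Defensive.

(** Both counts are compared with a third object, the [admissible] families of pairs [a < b <= n]:
    they contain every side [(a, a + 1)] and the root [(0, n)], have no crossing, and no pair is cut
    exactly into two or three consecutive pairs.

    The value intervals of a block-wise simple permutation form such a family
    ([blockwise_simple_admissible]), since by [inflation_intervalP] every interval but the whole
    lies in one of at least four blocks. Conversely every such family arises in this way
    ([admissible_realized]): the root has at least four children ([admissible_children]), a simple
    permutation of that size exists ([exists_simple]), and the blocks are built by induction.

    On the polygon, [placement_admissible] says that a set of diagonals is a valid placement exactly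
    when, together with the sides, it is admissible. There [crossing] and [uncrossed] turn the
    geometric condition into one on the order of the indices, [triangle_region] and
    [quadrilateral_region] turn a forbidden pattern into a forbidden region, and [cell_not_small]
    shows that without such patterns no region is the interior of a triangle or a quadrilateral. The
    injective map [chord_intervals] then carries the placements onto the posets. *)

(** * Intervals as half-open ranges of values *)

Definition value_range n a b : {set 'I_n} := [set x : 'I_n | a <= x < b]%SET.

(** Endpoints are plain naturals with the right one excluded, so that adjacent intervals share an
    endpoint, as the chords [(a, b)] and [(b, c)] do. *)
Definition value_interval n (pi : 'S_n) a b : Prop :=
  a < b <= n /\
  exists i j, i < j <= n /\ forall x : 'I_n, (i <= x < j) = (a <= pi x < b).

Lemma perm_intervalP n (pi : 'S_n) A :
  perm_interval pi A <-> exists a b, value_interval pi a b /\ A = value_range n a b.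
Proof.
split.
  case/and3P=> /set0Pn[x xA] /existsP[i /existsP[j /eqP Aij]].
  move=> /existsP[a /existsP[b /eqP Aab]].
  have/andP[ax xb] : a <= x <= b by move: xA; rewrite Aab inE.
  exists a, b.+1; split; last by rewrite Aab; apply/setP=> y; rewrite !inE.
  split; first by have := ltn_ord b; lia.
  have/imsetP[y] : x \in [set pi x | x in segment_ord i j]%SET by rewrite -Aij.
  rewrite inE => /andP[iy yj] _.
  exists i, j.+1; split; first by have := ltn_ord j; lia.
  move=> z; have := mem_imset (segment_ord i j) z (@perm_inj _ pi).
  by rewrite -Aij Aab !inE !ltnS => ->.
case=> a [b [[/andP[ab bn] [i [j [/andP[ij jn] H]]]] ->]].
have an : a < n by apply: leq_trans bn.
have b1n : b.-1 < n by case: b ab bn {H}.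
have iN : i < n by apply: leq_trans jn.
have j1n : j.-1 < n by case: j ij jn {H}.
apply/and3P; split.
- by apply/set0Pn; exists (Ordinal an); rewrite inE /= leqnn.
- apply/existsP; exists (Ordinal iN); apply/existsP; exists (Ordinal j1n).
  apply/eqP/setP=> x; rewrite -[x](permKV pi) mem_imset; last exact: perm_inj.
  by rewrite !inE -H /=; case: j ij {jn j1n H} => // j; rewrite ltnS.
- apply/existsP; exists (Ordinal an); apply/existsP; exists (Ordinal b1n).
  by apply/eqP/setP=> x; rewrite !inE /=; case: b ab {bn b1n H} => // b; rewrite ltnS.
Qed.

Lemma value_range_inj n a b c d : a < b <= n -> c < d <= n ->
  value_range n a b = value_range n c d ->
  a = c /\ b = d.
Proof.
move=> /andP[ab bn] /andP[cd dn] /setP e.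
have {}e x : x < n -> (a <= x < b) = (c <= x < d).
  by move=> xn; have := e (Ordinal xn); rewrite !inE.
have := e a; have := e b.-1; have := e c; have := e d.-1; lia.
Qed.

Lemma card_value_range n a b : b <= n -> #|value_range n a b| = b - a.
Proof.
move=> bn; rewrite cardE -(size_map val).
have -> : [seq val i | i <- enum (value_range n a b)] = iota a (b - a).
  apply: (@sorted_eq _ ltn) => //.
  - exact: ltn_trans.
  - by move=> x y; lia.
  - rewrite (@sorted_map _ _ val) /=.
    have -> : enum (value_range n a b) = [seq x <- enum 'I_n | x \in value_range n a b].
      by rewrite {1}/enum_mem -enumT.
    apply: sorted_filter; first by move=> x y z; apply: ltn_trans.
    by rewrite -(@sorted_map _ _ val) val_enum_ord iota_ltn_sorted.
  - exact: iota_ltn_sorted.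
  apply: uniq_perm; rewrite ?iota_uniq ?(map_inj_uniq val_inj) ?enum_uniq //.
  move=> x; rewrite mem_iota; apply/mapP/idP => [[y]|H].
    by rewrite mem_enum inE => H -> /=; lia.
  have xn : x < n by lia.
  by exists (Ordinal xn) => //; rewrite mem_enum inE /=; lia.
by rewrite size_iota.
Qed.

Lemma simple_permP n (pi : 'S_n) :
  simple_perm pi <->
  (forall a b, value_interval pi a b -> a = 0 /\ b = n \/ b = a.+1).
Proof.
split.
  move=> /forallP H a b abI; have /negP nab := H (value_range n a b).
  case: (abI) => /andP[ab bn] _.
  case: (eqVneq b a.+1) => [->|b1]; [by right|left].
  case: (eqVneq (a, b) (0, n)) => [[-> ->]//|abn]; case: nab.
  apply/and3P; split; first by apply/perm_intervalP; exists a, b.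
    apply: contra abn => /eqP/(congr1 (fun A : {set _} => #|A|)).
    by rewrite card_value_range // cardsT card_ord => E; apply/eqP; congr (_, _); lia.
  by rewrite card_value_range //; lia.
move=> H; apply/forallP => A; apply/negP => /and3P[/perm_intervalP[a [b [abI ->]]]].
have [[-> ->]|->] := H _ _ abI.
  by move=> /eqP[]; apply/setP=> x; rewrite !inE /= ltn_ord.
case: abI => /andP[ab bn] _.
by rewrite card_value_range //; lia.
Qed.

(** * Inflations *)

Section Offset.
Variables (k : nat) (m : 'I_k -> nat) (r : 'S_k).

(** With [r = 1] this is where the positions of block [i] start, with [r = sigma] where its values
    start; the two directions share the lemmas of this section. *)
Definition block_offset (i : 'I_k) := \sum_(j < k | r j < r i) m j.

Lemma block_offsetS i : \sum_(j < k | r j < (r i).+1) m j = block_offset i + m i.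
Proof.
rewrite (bigD1 i) //= addnC; congr (_ + _).
apply: eq_bigl => j; rewrite ltnS ltn_neqAle andbC; congr (_ && _).
by rewrite -(inj_eq (@perm_inj _ r)).
Qed.

Lemma block_offset_le i j : r i < r j -> block_offset i + m i <= block_offset j.
Proof.
move=> rij; rewrite -block_offsetS /block_offset big_mkcond [X in _ <= X]big_mkcond /=.
by apply: leq_sum => l _; do 2 case: ifP => //; lia.
Qed.

Lemma block_offset_last i : (r i).+1 = k -> block_offset i + m i = \sum_(j < k) m j.
Proof. by move=> e; rewrite -block_offsetS e; apply: eq_bigl => j; rewrite ltn_ord. Qed.

Lemma block_offset_max i : block_offset i + m i <= \sum_(j < k) m j.
Proof.
rewrite -block_offsetS big_mkcond /=.
by apply: leq_sum => l _; case: ifP.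
Qed.

Lemma block_offset_cover x : x < \sum_(j < k) m j ->
  exists i (y : 'I_(m i)), x = block_offset i + y.
Proof.
move=> xN.
have k0 : 0 < k by case: (k) m xN => // m'; rewrite big_ord0.
have i0P : block_offset ((r^-1)%g (Ordinal k0)) <= x.
  by rewrite /block_offset permKV big1 // => j; rewrite /= ltn0.
(* The block of [x] has the highest rank among those that start at or before [x]. *)
case: (@arg_maxnP _ ((r^-1)%g (Ordinal k0)) (fun i => block_offset i <= x)
  (fun i => r i : nat) i0P) => i ix imax.
suff y : x - block_offset i < m i by exists i, (Ordinal y); rewrite /= subnKC.
rewrite ltnNge; apply/negP => H.
have : block_offset i + m i <= x by lia.
case: (ltnP (r i).+1 k) => rik; last by rewrite block_offset_last //; have := ltn_ord (r i); lia.
have e : r ((r^-1)%g (Ordinal rik)) = (r i).+1 :> nat by rewrite permKV.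
rewrite -block_offsetS -e => /imax; rewrite e; lia.
Qed.

End Offset.

Lemma nth_one_line n (pi : 'S_n) (x : 'I_n) : nth 0 (one_line pi) x = pi x.
Proof. by rewrite (nth_map x) ?size_enum_ord // nth_ord_enum. Qed.

Lemma size_one_line n (pi : 'S_n) : size (one_line pi) = n.
Proof. by rewrite size_map size_enum_ord. Qed.

Lemma nth_flatten_enum k (F : 'I_k -> seq nat) (i : 'I_k) y : y < size (F i) ->
  nth 0 (flatten [seq F i | i <- enum 'I_k]) (\sum_(j < k | j < i) size (F j) + y)
  = nth 0 (F i) y.
Proof.
move=> ys.
have e : \sum_(j < k | j < i) size (F j) = size (flatten [seq F i | i <- take i (enum 'I_k)]).
  rewrite size_flatten sumnE !big_map.
  have -> : take i (enum 'I_k) = [seq j : 'I_k <- enum 'I_k | j < i].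
    apply: (inj_map val_inj); rewrite map_take val_enum_ord.
    rewrite -(filter_map val (fun x => x < i)) val_enum_ord.
    by rewrite (filter_iota_ltn 0) ?take_iota ?(minn_idPl _) // ltnW.
  by rewrite big_filter big_enum_cond.
rewrite -{1}(cat_take_drop i (enum 'I_k)) map_cat flatten_cat nth_cat -e.
rewrite ltnNge leq_addr /= addKn (drop_nth i) ?size_enum_ord //= nth_ord_enum nth_cat ys //.
Qed.

Section Inflation.
Variables (k : nat) (sigma : 'S_k) (m : 'I_k -> nat) (alpha : forall i : 'I_k, 'S_(m i)).
Local Notation po := (block_offset m 1%g).
Local Notation vo := (block_offset m sigma).

Lemma size_inflation : size (inflation sigma alpha) = \sum_(i < k) m i.
Proof.
rewrite /inflation size_flatten sumnE !big_map -enumT big_enum /=.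
by apply: eq_bigr => i _; rewrite size_map size_one_line.
Qed.

Lemma nth_inflation (i : 'I_k) (y : 'I_(m i)) :
  nth 0 (inflation sigma alpha) (po i + y) = vo i + alpha i y.
Proof.
rewrite /inflation.
have -> : po i = \sum_(j < k | j < i) size [seq vo j + a | a <- one_line (alpha j)].
  by apply: eq_big => [j|j _]; rewrite ?perm1 // size_map size_one_line.
rewrite nth_flatten_enum; last by rewrite size_map size_one_line.
by rewrite (nth_map 0) ?nth_one_line ?size_one_line.
Qed.

(** The word has length [n] and contains every value below [n], hence has no repetition. *)
Lemma inflation_perm : exists pi : 'S_(\sum_(i < k) m i), one_line pi = inflation sigma alpha.
Proof.
set n := \sum_(i < k) m i; set s := inflation sigma alpha.
have sub : {subset iota 0 n <= s}.
  move=> x; rewrite mem_iota /= => xn.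
  have [i [y ->]] := block_offset_cover sigma xn.
  rewrite -[y](permKV (alpha i)) -nth_inflation mem_nth // size_inflation.
  by apply: leq_trans (block_offset_max m 1%g i); rewrite ltn_add2l.
have us : uniq s.
  by apply: leq_size_uniq (iota_uniq 0 n) sub _; rewrite size_inflation size_iota.
have [|_ eqs] := uniq_min_size (iota_uniq 0 n) sub.
  by rewrite size_inflation size_iota.
have bd (x : 'I_n) : nth 0 s x < n.
  have : nth 0 s x \in s by rewrite mem_nth // size_inflation.
  by rewrite -eqs mem_iota.
have inj : injective (fun x : 'I_n => Ordinal (bd x)).
  move=> x y /(congr1 val)/= /eqP; rewrite nth_uniq ?size_inflation // => /eqP; exact: val_inj.
exists (perm inj); apply: (@eq_from_nth _ 0); first by rewrite size_one_line size_inflation.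
rewrite size_one_line => i iN.
by rewrite (nth_one_line _ (Ordinal iN)) permE.
Qed.

End Inflation.

Lemma value_interval_whole n (pi : 'S_n) : 0 < n -> value_interval pi 0 n.
Proof.
move=> n0; split; first by rewrite n0 leqnn.
by exists 0, n; split; [rewrite n0 leqnn|move=> x; rewrite !ltn_ord].
Qed.

(** [u0] and [u1] are the blocks that contain [i] and [j - 1]; blocks are disjoint and ordered by
    rank, so those that meet the range are ranked between the two. *)
Lemma block_offset_touch k (m : 'I_k -> nat) (r : 'S_k) i j : (forall t, 0 < m t) ->
  i < j <= \sum_(t < k) m t ->
  exists u0 u1, [/\ r u0 <= r u1, block_offset m r u0 <= i < block_offset m r u0 + m u0,
    block_offset m r u1 < j <= block_offset m r u1 + m u1 &
    forall u, (block_offset m r u < j) && (i < block_offset m r u + m u) =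
      (r u0 <= r u < (r u1).+1)].
Proof.
move=> m0 /andP[ij jN].
have [u0 [y0 e0]] : exists i0 (y : 'I_(m i0)), i = block_offset m r i0 + y.
  by apply: block_offset_cover; apply: leq_trans jN.
have [u1 [y1 e1]] : exists i0 (y : 'I_(m i0)), j.-1 = block_offset m r i0 + y.
  by apply: block_offset_cover; lia.
have := ltn_ord y0; have := ltn_ord y1 => y1m y0m.
exists u0, u1; split; try lia.
- by rewrite leqNgt; apply/negP => /(@block_offset_le _ m); lia.
move=> u; have mu := m0 u.
have le0 : r u < r u0 -> block_offset m r u + m u <= block_offset m r u0 by apply: block_offset_le.
have ge0 : r u0 < r u -> block_offset m r u0 + m u0 <= block_offset m r u by apply: block_offset_le.
have le1 : r u < r u1 -> block_offset m r u + m u <= block_offset m r u1 by apply: block_offset_le.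
have ge1 : r u1 < r u -> block_offset m r u1 + m u1 <= block_offset m r u by apply: block_offset_le.
have eq0 : r u0 = r u :> nat -> u0 = u by move=> /val_inj/perm_inj.
have eq1 : r u1 = r u :> nat -> u1 = u by move=> /val_inj/perm_inj.
have [a0|a0|a0] := ltngtP (r u) (r u0); have [a1|a1|a1] := ltngtP (r u) (r u1);
  try (have ? := eq0 (esym a0); subst u0); try (have ? := eq1 (esym a1); subst u1); lia.
Qed.

(** * Intervals of an inflation *)

Section InflationIntervals.
Variables (k : nat) (sigma : 'S_k) (m : 'I_k -> nat) (alpha : forall i : 'I_k, 'S_(m i)).
Variables (n : nat) (pi : 'S_n).
Hypothesis k4 : 4 <= k.
Hypothesis sigmaS : simple_perm sigma.
Hypothesis m0 : forall i, 1 <= m i.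
Hypothesis piE : one_line pi = inflation sigma alpha.
Local Notation po := (block_offset m 1%g).
Local Notation vo := (block_offset m sigma).

Lemma inflation_size : n = \sum_(i < k) m i.
Proof. by rewrite -(size_inflation sigma alpha) -piE size_one_line. Qed.

Lemma inflation_valE (x : 'I_n) u (y : 'I_(m u)) : x = po u + y :> nat ->
  pi x = vo u + alpha u y :> nat.
Proof. by move=> e; rewrite -nth_one_line piE e nth_inflation. Qed.

Lemma inflation_pos (x : 'I_n) : exists u (y : 'I_(m u)), x = po u + y :> nat.
Proof. by apply: block_offset_cover; rewrite -inflation_size. Qed.

Lemma po_le (u t : 'I_k) : u < t -> po u + m u <= po t.
Proof. by move=> ut; apply: block_offset_le; rewrite !perm1. Qed.

Lemma inflation_interval_block t a b : value_interval (alpha t) a b ->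
  value_interval pi (vo t + a) (vo t + b).
Proof.
case=> [/andP[ab bm] [i [j [/andP[ij jm] H]]]].
have := block_offset_max m sigma t; have := block_offset_max m 1%g t.
rewrite -inflation_size => pm vm.
split; first lia.
exists (po t + i), (po t + j); split; first lia.
move=> x; have [u [y e]] := inflation_pos x; rewrite (inflation_valE e) e.
have := ltn_ord y; have := ltn_ord (alpha u y).
have [ut|ut] := eqVneq u t; first by subst u; have := H y; lia.
have {}ut : sigma u != sigma t :> nat.
  by apply: contra ut => /eqP/val_inj/perm_inj ->.
have ut' : u != t :> nat by apply: contra ut => /eqP/val_inj ->.
have pu : po u + m u <= po t \/ po t + m t <= po u.
  by case: (ltngtP u t) ut' => // /po_le; auto.
have vu : vo u + m u <= vo t \/ vo t + m t <= vo u.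
  by case: (ltngtP (sigma u) (sigma t)) ut => // /(block_offset_le m); auto.
by move=> ? ?; apply/idP/idP; lia.
Qed.

(** Deleting an entry extremal in both position and value would leave an interval of [k - 1 >= 3]
    entries, which is proper. *)
Lemma simple_remove_extremal (t : 'I_k) :
  t = 0 :> nat \/ t.+1 = k -> sigma t = 0 :> nat \/ (sigma t).+1 = k -> False.
Proof.
move=> tE sE.
have neq (u : 'I_k) : (sigma u == sigma t :> nat) = (u == t :> nat).
  by rewrite (inj_eq val_inj) (inj_eq perm_inj).
set a : nat := sigma t == 0 :> nat; set i : nat := t == 0 :> nat.
have : value_interval sigma a (a + k.-1).
  split; first by rewrite /a; lia.
  exists i, (i + k.-1); split; first by rewrite /i; lia.
  move=> u; have := neq u; have := ltn_ord u; have := ltn_ord (sigma u).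
  by rewrite /a /i; lia.
by move/simple_permP: sigmaS => H /H; lia.
Qed.

(* The blocks met by an interval of [pi] form an interval of [sigma], hence   *)
(* are a single block or all of them; in the latter case a missing value      *)
(* would lie in a block that is extremal in both position and value.          *)
Lemma inflation_intervalP a b :
  value_interval pi a b <-> (a = 0 /\ b = n) \/
    exists t a' b', [/\ value_interval (alpha t) a' b', a = vo t + a' & b = vo t + b'].
Proof.
have n0 : 0 < n.
  rewrite inflation_size; have k0 : 0 < k by lia.
  by rewrite (bigD1 (Ordinal k0)) //=; have := m0 (Ordinal k0); lia.
split; last first.
  case=> [[-> ->]|[t [a' [b' [H -> ->]]]]]; first exact: value_interval_whole.
  exact: inflation_interval_block.
case=> [abn [i [j [ijn H]]]].
have abN := abn; have ijN := ijn; rewrite inflation_size in abN ijN.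
have [u0 [u1 [u01 u0i u1j Tp]]] := block_offset_touch 1%g m0 ijN.
have [w0 [w1 [w01 w0a w1b Tv]]] := block_offset_touch sigma m0 abN.
rewrite !perm1 in u01.
(* A block meets the range of positions exactly when it meets the range of values: the first common
   point, [maxn i (po u)] or [maxn a (vo u)], is carried across by [alpha u] or its inverse. *)
have Tpv (u : 'I_k) : (u0 <= u < u1.+1) = (sigma w0 <= sigma u < (sigma w1).+1).
  have := Tp u; rewrite !perm1 => <-; rewrite -Tv.
  have pm := block_offset_max m 1%g u; rewrite -inflation_size in pm.
  apply/idP/idP => /andP[h1 h2].
    have ym : maxn i (po u) - po u < m u by have := m0 u; lia.
    have xn : maxn i (po u) < n by lia.
    have e : Ordinal xn = po u + Ordinal ym :> nat by rewrite /=; lia.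
    have := inflation_valE e; have := H (Ordinal xn) => /=.
    have := ltn_ord (alpha u (Ordinal ym)); lia.
  have zm : maxn a (vo u) - vo u < m u by have := m0 u; lia.
  pose y := ((alpha u)^-1)%g (Ordinal zm).
  have xn : po u + y < n by have := ltn_ord y; lia.
  have e : Ordinal xn = po u + y :> nat by [].
  have := inflation_valE e; rewrite permKV; have := H (Ordinal xn) => /=.
  have := ltn_ord y; lia.
have sI : value_interval sigma (sigma w0) (sigma w1).+1.
  split; first by have := ltn_ord (sigma w1); lia.
  by exists u0, u1.+1; split=> //; have := ltn_ord u1; lia.
move/simple_permP: (sigmaS) => /(_ _ _ sI)[[s0 s1]|s01]; last first.
  have w10 : w1 = w0 by apply/(@perm_inj _ sigma)/val_inj/eq_add_S.
  subst w1; set t := w0 in s01 Tv Tpv w0a w1b *.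
  have := Tpv t; rewrite leqnn ltnSn /= => /andP[t0 t1].
  have eu0 : u0 = t.
    by apply/(@perm_inj _ sigma)/val_inj; have := Tpv u0; rewrite leqnn /= ; lia.
  have eu1 : u1 = t.
    by apply/(@perm_inj _ sigma)/val_inj; have := Tpv u1; rewrite ltnSn /= ; lia.
  subst u0 u1; right; exists t, (a - vo t), (b - vo t).
  split; [|lia|lia]; split; first lia.
  exists (i - po t), (j - po t); split; first lia.
  move=> y; have pm := block_offset_max m 1%g t; rewrite -inflation_size in pm.
  have ym := ltn_ord y; have xn : po t + y < n by lia.
  have e : Ordinal xn = po t + y :> nat by [].
  by have := inflation_valE e; have := H (Ordinal xn) => /=; lia.
case: (eqVneq (a, b) (0, n)) => [[-> ->]|ab0n]; first by left.
exfalso.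
have vm0 := block_offset_max m sigma w0; have vm1 := block_offset_max m sigma w1.
have e0 : vo w0 = 0 by rewrite /block_offset s0 big_pred0.
have e1 : vo w1 + m w1 = n by rewrite block_offset_last // -inflation_size.
(* The missing value [z] is [0] if [a > 0] and [n - 1] otherwise. *)
have [z [t [zt tE zab]]] : exists z t, [/\ vo t <= z < vo t + m t,
   sigma t = 0 :> nat \/ (sigma t).+1 = k & ~~ (a <= z < b)].
  case: (posnP a) => a0.
    exists n.-1, w1; split; first by have := m0 w1; lia.
      by right.
    have : b != n by apply: contra ab0n => /eqP ->; rewrite a0.
    lia.
  by exists 0, w0; split; [have := m0 w0; lia|left|lia].
have zm : z - vo t < m t by lia.
pose y := ((alpha t)^-1)%g (Ordinal zm).
have pm := block_offset_max m 1%g t; rewrite -inflation_size in pm.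
have ym := ltn_ord y; have xn : po t + y < n by lia.
have e : Ordinal xn = po t + y :> nat by [].
have := inflation_valE e; rewrite permKV; have := H (Ordinal xn) => /= Hx ex.
apply: (@simple_remove_extremal t) => //.
(* Every block is met, so all blocks but the first and the last in position lie wholly in the range;
   the block [t] of the missing value is one of these two. *)
have Tall (u : 'I_k) : u0 <= u <= u1.
  by rewrite -ltnS Tpv s0 s1 ltn_ord.
have k0 : 0 < k by lia.
have k1 : k.-1 < k by lia.
have /= u00 := Tall (Ordinal k0); have /= u1k := Tall (Ordinal k1).
case: (posnP t) => [|t0]; [by left|right].
apply/eqP; rewrite eqn_leq ltn_ord /= leqNgt; apply/negP => tk.
have : po u0 + m u0 <= po t by apply: po_le; lia.
have : po t + m t <= po u1 by apply: po_le; lia.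
clear -zab Hx ex ym zt zm u0i u1j; lia.
Qed.

End InflationIntervals.

(** * Simple permutations of every size at least four *)

(* In one-line notation: 2 4 ... 2h 1 [2h+1] 3 5 ... (2h-1), the bracketed    *)
(* entry being present for odd k only.                                        *)
Definition parity_word k p : nat :=
  let h := k./2 in
  if p < h then p.*2.+1 else if p == h then 0 else
  if odd k then (if p == h.+1 then k.-1 else (p - h).*2 - 2) else (p - h).*2.

(** Counting from 0, the odd values fill the positions before [h] and the even values the others. An
    interval with two values contains consecutive ones, of opposite parity, so it covers the
    positions [h - 1] and [h], which hold [2h - 1] and [0]. Hence it contains all values in between,
    among them those at the first and the last position, and it is everything. *)
Lemma exists_simple k : 4 <= k -> exists sigma : 'S_k, simple_perm sigma.
Proof.
move=> k4; set h := k./2.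
have kE : k = odd k + h.*2 by rewrite odd_double_half.
have h2 : 2 <= h by lia.
have bd (p : 'I_k) : parity_word k p < k.
  by have := ltn_ord p; rewrite /parity_word -/h; do 4?case: ifP; lia.
have odd_word p : odd (parity_word k p) = (p < h).
  rewrite /parity_word -/h; by do 4?case: ifP => ?; lia.
have inj : injective (fun p : 'I_k => Ordinal (bd p)).
  move=> p q /(congr1 val) /= e; apply: val_inj; move: e => /=.
  have := ltn_ord p; have := ltn_ord q; rewrite /parity_word -/h.
  by do 8?case: ifP => ?; lia.
exists (perm inj); apply/simple_permP => a b [abk [i [j [ij H]]]].
have [->|ba] := eqVneq b a.+1; [by right|left].
have k0 : 0 < k by lia.
have ab2 : a.+1 < b by lia.
have {}H p : p < k -> (i <= p < j) = (a <= parity_word k p < b).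
  by move=> pk; have := H (Ordinal pk); rewrite permE.
have surj z : z < k -> exists2 p, p < k & parity_word k p = z.
  move=> zk; exists (((perm inj)^-1)%g (Ordinal zk)) => //.
  by have /(congr1 val) := permKV (perm inj) (Ordinal zk); rewrite permE.
have [p pk pa] := surj a ltac:(lia); have [q qk qa] := surj a.+1 ltac:(lia).
have := H p pk; have := H q qk; have := odd_word p; have := odd_word q.
rewrite pa qa /= => oq op Hq Hp.
have wh1 : parity_word k h.-1 = h.*2.-1 by rewrite /parity_word -/h; case: ifP; lia.
have wh : parity_word k h = 0 by rewrite /parity_word -/h ltnn eqxx.
have w0 : parity_word k 0 = 1 by rewrite /parity_word -/h; case: ifP; lia.
have wk : parity_word k k.-1 < h.*2.-1.
  by rewrite /parity_word -/h; do 4?case: ifP; lia.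
have hk : h < k by clear -kE h2; lia.
have h1k : h.-1 < k by clear -kE h2; lia.
have k1 : k.-1 < k by clear -k4; lia.
have := H _ h1k; have := H _ hk; have := H _ k0; have := H _ k1; rewrite wh1 wh w0 => Hk H0 Hh Hh1.
have [r rk rE] := surj _ k1; have Hr := H r rk; rewrite rE in Hr.
have Hp' : i <= p < j by rewrite Hp leqnn; case/andP: abk.
have Hq' : i <= q < j by rewrite Hq leqnSn.
have pq : (p < h) = ~~ (q < h) by rewrite -op -oq negbK.
have ih : i <= h.-1 by clear -Hp' Hq' pq; lia.
have jh : h < j by clear -Hp' Hq' pq; lia.
have a0 : a = 0 by clear -Hh jh ih h2; lia.
have b2h : h.*2.-1 < b by clear -Hh1 jh ih h2; lia.
have i0 : i = 0 by clear -H0 a0 b2h h2; lia.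
have jk : k.-1 < j by clear -Hk a0 b2h h2 wk; lia.
by split=> //; clear -Hr abk rE rk i0 jk; lia.
Qed.

(** * Admissible families and block-wise simple permutations *)

(** A triangle or quadrilateral with increasing vertices has one side spanning the others, whence
    the form of the last two fields. *)
Record admissible n (E : nat -> nat -> Prop) : Prop := Admissible {
  admissible_bound : forall a b, E a b -> a < b <= n;
  admissible_side : forall a, a < n -> E a a.+1;
  admissible_root : E 0 n;
  admissible_laminar : forall a b c d, E a b -> E c d -> a < c -> c < b -> b < d -> False;
  admissible_triangle : forall a b c, E a b -> E b c -> E a c -> False;
  admissible_quadrilateral : forall a b c d, E a b -> E b c -> E c d -> E a d -> False }.

Lemma value_interval_single n (pi : 'S_n) a : a < n -> value_interval pi a a.+1.
Proof.
move=> an; split; first lia.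
pose i := ((pi^-1)%g (Ordinal an)).
exists i, i.+1; split; first by have := ltn_ord i; lia.
move=> x; have -> : (i <= x < i.+1) = (x == i) by rewrite -(inj_eq val_inj) /=; lia.
rewrite -(inj_eq (@perm_inj _ pi)) /i permKV -(inj_eq val_inj) /=; lia.
Qed.

(** A forbidden pattern that avoids the whole interval sits inside one block, where induction
    applies; one that uses it would cover all the blocks by at most three. *)
Lemma blockwise_simple_admissible n (pi : 'S_n) : blockwise_simple pi ->
  admissible n (value_interval pi).
Proof.
elim=> {n pi} [pi|n pi k sigma m alpha k4 sS m0 aS IH piE].
  have bd a b : value_interval pi a b -> a < b <= 1 by case.
  split=> //.
  - by move=> a; exact: value_interval_single.
  - exact: value_interval_whole.
  - by move=> a b c d /bd + /bd; lia.
  - by move=> a b c /bd + /bd; lia.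
  - by move=> a b c d /bd + /bd; lia.
have P := inflation_intervalP k4 sS m0 piE.
have nE := inflation_size piE.
have n0 : 0 < n.
  have k0 : 0 < k by lia.
  by rewrite nE (bigD1 (Ordinal k0)) //=; have := m0 (Ordinal k0); lia.
have bd a b : value_interval pi a b -> a < b <= n by case.
have bdb t a b : value_interval (alpha t) a b -> a < b <= m t by case.
pose vo := block_offset m sigma.
have same t u z : vo t <= z < vo t + m t -> vo u <= z < vo u + m u -> t = u.
  move=> zt zu; apply/(@perm_inj _ sigma)/val_inj => /=.
  by case: (ltngtP (sigma t) (sigma u)) => // /(@block_offset_le _ m); rewrite -!/(vo _); lia.
(* As [k >= 4], three blocks, repetitions allowed, cannot contain all the values. *)
have cover t1 t2 t3 : (forall z, z < n -> exists2 t, t \in [:: t1; t2; t3] &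
    vo t <= z < vo t + m t) -> False.
  move=> C; have : #|'I_k| <= size [:: t1; t2; t3].
    apply: leq_trans (card_size _); apply/subset_leq_card/fintype.subsetP => u _.
    have um := block_offset_max m sigma u; rewrite -nE -/(vo u) in um.
    have [|t tin zt] := C (vo u); first by have := m0 u; lia.
    by rewrite (same u t (vo u)) //; have := m0 u; lia.
  by rewrite card_ord /=; lia.
have inb a b : value_interval pi a b -> ~ (a = 0 /\ b = n) -> exists t a' b',
    [/\ value_interval (alpha t) a' b', a = vo t + a' & b = vo t + b'].
  by move/P => [].
have sub a b c d t a' b' : value_interval (alpha t) a' b' -> a = vo t + a' -> b = vo t + b' ->
    value_interval pi c d -> a <= c -> d <= b -> ~ (c = 0 /\ d = n) ->
    exists c' d', [/\ value_interval (alpha t) c' d', c = vo t + c' & d = vo t + d'].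
  move=> ab' ea eb cd ac db nr; have [u [c' [d' [cd' ec ed]]]] := inb _ _ cd nr.
  have := bdb _ _ _ ab'; have := bdb _ _ _ cd' => bu bt.
  have tu : t = u by apply: (same t u c); lia.
  by subst u; exists c', d'.
split=> //.
- by move=> a; exact: value_interval_single.
- exact: value_interval_whole.
- move=> a b c d ab cd ac cb bd'.
  have := bd _ _ ab; have := bd _ _ cd => bcd bab.
  have [|t [a' [b' [ab' ea eb]]]] := inb _ _ ab; first lia.
  have [|u [c' [d' [cd' ec ed]]]] := inb _ _ cd; first lia.
  have := bdb _ _ _ ab'; have := bdb _ _ _ cd' => bu bt.
  have tu : t = u by apply: (same t u c); lia.
  by subst u; apply: (admissible_laminar (IH t) ab' cd'); lia.
- move=> a b c ab bc ac.
  have := bd _ _ ab; have := bd _ _ bc => bbc bab.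
  have [[a0 cn]|nr] := pselect (a = 0 /\ c = n).
    have [|t [a' [b' [ab' ea eb]]]] := inb _ _ ab; first lia.
    have [|u [b2 [c2 [bc' eb2 ec]]]] := inb _ _ bc; first lia.
    have := bdb _ _ _ ab'; have := bdb _ _ _ bc' => bu bt.
    apply: (cover t t u) => z zn; case: (ltnP z b) => zb.
      by exists t; [rewrite !inE eqxx|lia].
    by exists u; [rewrite !inE eqxx !orbT|lia].
  have [t [a' [c' [ac' ea ec]]]] := inb _ _ ac nr.
  have [|||a1 [b1 [ab1 ea1 eb1]]] := sub _ _ _ _ _ _ _ ac' ea ec ab; try lia.
  have [|||b2 [c2 [bc2 eb2 ec2]]] := sub _ _ _ _ _ _ _ ac' ea ec bc; try lia.
  apply: (admissible_triangle (IH t) (a := a') (b := b1) (c := c')) => //.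
    by have -> : a' = a1 by lia.
  by have [-> ->] : b1 = b2 /\ c' = c2 by lia.
- move=> a b c d ab bc cd ad.
  have := bd _ _ ab; have := bd _ _ bc; have := bd _ _ cd => bcd bbc bab.
  have [[a0 dn]|nr] := pselect (a = 0 /\ d = n).
    have [|t [a' [b' [ab' ea eb]]]] := inb _ _ ab; first lia.
    have [|u [b2 [c2 [bc' eb2 ec]]]] := inb _ _ bc; first lia.
    have [|w [c3 [d3 [cd' ec3 ed3]]]] := inb _ _ cd; first lia.
    have := bdb _ _ _ ab'; have := bdb _ _ _ bc'; have := bdb _ _ _ cd' => bw bu bt.
    apply: (cover t u w) => z zn; case: (ltnP z b) => zb.
      by exists t; [rewrite !inE eqxx|lia].
    case: (ltnP z c) => zc; first by exists u; [rewrite !inE eqxx !orbT|lia].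
    by exists w; [rewrite !inE eqxx !orbT|lia].
  have [t [a' [d' [ad' ea ed]]]] := inb _ _ ad nr.
  have [|||a1 [b1 [ab1 ea1 eb1]]] := sub _ _ _ _ _ _ _ ad' ea ed ab; try lia.
  have [|||b2 [c2 [bc2 eb2 ec2]]] := sub _ _ _ _ _ _ _ ad' ea ed bc; try lia.
  have [|||c3 [d3 [cd3 ec3 ed3]]] := sub _ _ _ _ _ _ _ ad' ea ed cd; try lia.
  apply: (admissible_quadrilateral (IH t) (a := a') (b := b1) (c := c2) (d := d')) => //.
  + by have -> : a' = a1 by lia.
  + by have -> : b1 = b2 by lia.
  + by have [-> ->] : c2 = c3 /\ d' = d3 by lia.
Qed.

Lemma subdivision (P : nat -> Prop) n : P 0 -> P n ->
  exists k (c : nat -> nat), [/\ c 0 = 0, c k = n,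
    forall t, t < k -> c t < c t.+1, forall t, t <= k -> P (c t) &
    forall t x, t < k -> c t < x < c t.+1 -> ~ P x].
Proof.
move=> P0; have [N nN] := ubnP n; elim: N n nN => // N IH n nN Pn.
have [->|n0] := eqVneq n 0.
  by exists 0, (fun=> 0); split=> // t; rewrite leqn0 => /eqP ->.
pose Q x := (x < n) && `[< P x >].
have exQ : exists x, Q x by exists 0; rewrite /Q lt0n n0; apply/asboolP.
have bdQ x : Q x -> x <= n by case/andP => /ltnW.
have [p /andP[pn /asboolP Pp] pmax] := ex_maxnP exQ bdQ.
have [|k [c [c0 ck cS cP cN]]] := IH p _ Pp; first by apply: leq_trans pn _.
exists k.+1, (fun t => if t <= k then c t else n); split=> //.
- by rewrite ltnn.
- move=> t tk; have tk' : t <= k by []; rewrite tk'.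
  case: (ltnP t k) => h; first exact: cS.
  by have -> : t = k; [lia|rewrite ck].
- by move=> t tk; case: (leqP t k) => h //; apply: cP.
- move=> t x tk; have tk' : t <= k by []; rewrite tk'.
  case: (ltnP t k) => h; first exact: cN.
  have -> : t = k by lia.
  rewrite ck => /andP[px xn] /asboolP Px.
  by have := pmax x; rewrite /Q xn Px leqNgt px => /(_ isT).
Qed.

Lemma locate_step (c : nat -> nat) k x : c 0 <= x < c k ->
  exists2 t, t < k & c t <= x < c t.+1.
Proof.
elim: k => [|k IH]; first by lia.
case: (ltnP x (c k)) => xk H; last by exists k => //; lia.
by have [|t tk ?] := IH; [lia|exists t => //; lia].
Qed.

(* The [c t] are the points strictly inside no chord but (0, n).              *)
Lemma admissible_children n E : 1 < n -> admissible n E ->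
  exists k (c : nat -> nat), [/\ 4 <= k, c 0 = 0 /\ c k = n,
    forall t, t < k -> c t < c t.+1 &
    (forall t, t < k -> E (c t) (c t.+1)) /\
    forall a b, E a b -> ~ (a = 0 /\ b = n) -> exists2 t, t < k & c t <= a /\ b <= c t.+1].
Proof.
move=> n1 G.
pose P x := forall a b, E a b -> ~ (a = 0 /\ b = n) -> ~ (a < x < b).
have P0 : P 0 by move=> a b _ _; lia.
have Pn : P n by move=> a b /(admissible_bound G); lia.
have [k [c [c0 ck cS cP cN]]] := subdivision P0 Pn.
have cn t : t <= k -> c t <= n.
  move=> tk; rewrite -ck -(subnKC tk).
  have : t + (k - t) <= k by lia.
  elim: (k - t) => [|d IH] td; first by rewrite addn0.
  by rewrite addnS; apply: leq_trans (IH _) (ltnW (cS _ _)); lia.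
have cE t : t < k -> E (c t) (c t.+1) /\ ~ (c t = 0 /\ c t.+1 = n).
  move=> tk; set x := c t.
  (* The longest chord from [x] other than the root ends at a point of [P], hence at [c t.+1]: a
     chord straddling this end would cross it, be a longer one from [x], or straddle [x]. *)
  pose Q y := `[< E x y /\ ~ (x = 0 /\ y = n) >].
  have xn : x < n by apply: leq_trans (cS t tk) (cn _ _).
  have exQ : exists y, Q y.
    by exists x.+1; apply/asboolP; split; [exact: (admissible_side G)|lia].
  have bdQ y : Q y -> y <= n by move=> /asboolP[/(admissible_bound G)]; lia.
  have [y /asboolP[xy nxy] ymax] := ex_maxnP exQ bdQ.
  suff -> : c t.+1 = y by [].
  have ybd := admissible_bound G xy.
  have Py : P y.
    move=> a b ab nab /andP[ay yb]; have [ax|ax|ax] := ltngtP a x.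
    - by apply: (cP t (ltnW tk) a b ab nab); rewrite -/x; lia.
    - exact: (admissible_laminar G xy ab).
    - subst a; have := ymax b; rewrite leqNgt yb => H.
      by suff: false by []; apply: H; apply/asboolP.
  have [H|H|//] := ltngtP (c t.+1) y.
    by case: (cP t.+1 tk x y xy nxy); rewrite H andbT cS.
  by case: (cN t y tk _ Py); rewrite H andbT -/x; case/andP: ybd.
exists k, c; split=> //; last first.
  split=> [t /cE[]//|a b ab nab]; have abd := admissible_bound G ab.
  have [|t tk tb] := @locate_step c k a; first by rewrite c0 ck; lia.
  exists t => //; split; first lia.
  by rewrite leqNgt; apply/negP => H; apply: (cP t.+1 tk a b ab nab); lia.
(* The cases [k = 0, 1, 2, 3] mean [n = 0], the root as its own child, a triangle, and a
   quadrilateral. *)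
case: k ck cS cP cN cn cE => [|[|[|[|k]]]] // ck cS cP cN cn cE.
- lia.
- by have [_ []] := cE 0 isT.
- have [e1 _] := cE 0 isT; have [e2 _] := cE 1 isT; rewrite c0 ck in e1 e2.
  by case: (admissible_triangle G e1 e2 (admissible_root G)).
- have [e1 _] := cE 0 isT; have [e2 _] := cE 1 isT; have [e3 _] := cE 2 isT.
  rewrite c0 ck in e1 e2 e3.
  by case: (admissible_quadrilateral G e1 e2 e3 (admissible_root G)).
Qed.

Lemma admissible_shift n E s l : admissible n E -> 0 < l -> E s (s + l) ->
  admissible l (fun a b => E (s + a) (s + b) /\ b <= l).
Proof.
move=> G l0 Es; have sl := admissible_bound G Es; split.
- by move=> a b [/(admissible_bound G)]; lia.
- by move=> a al; split=> //; rewrite addnS; apply: (admissible_side G); lia.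
- by rewrite addn0.
- by move=> a b c d [ab _] [cd _] *; apply: (admissible_laminar G ab cd); lia.
- by move=> a b c [ab _] [bc _] [ac _]; apply: (admissible_triangle G ab bc ac).
- by move=> a b c d [ab _] [bc _] [cd _] [ad _]; apply: (admissible_quadrilateral G ab bc cd ad).
Qed.

Lemma sum_increments (c : nat -> nat) k s : (forall t, t < k -> c t < c t.+1) ->
  s <= k -> c 0 + \sum_(t < s) (c t.+1 - c t) = c s.
Proof.
move=> cS; elim: s => [|s IH] sk; first by rewrite big_ord0 addn0.
by rewrite big_ord_recr /= addnA IH 1?ltnW // subnKC // ltnW // cS.
Qed.

(** By [admissible_shift] the chords below each child of the root form a smaller admissible family.
    The permutations realizing them are put in the blocks of a simple permutation, and
    [inflation_intervalP] gives back the chords. *)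
Lemma admissible_realized n E : 0 < n -> admissible n E ->
  exists2 pi : 'S_n, blockwise_simple pi & forall a b, value_interval pi a b <-> E a b.
Proof.
have [N nN] := ubnP n; elim: N n nN E => // N IH n nN E n0 G.
have [n1|n1] := leqP n 1.
  have {}n1 : n = 1 by lia.
  subst n; exists 1%g; first by constructor.
  move=> a b; split=> [[ab _]|/(admissible_bound G) ab].
    have [-> ->] : a = 0 /\ b = 1 by lia.
    exact: (admissible_root G).
  have [-> ->] : a = 0 /\ b = 1 by lia.
  exact: value_interval_whole.
have [k [c [k4 [c0 ck] cS [cE cE']]]] := admissible_children n1 G.
have sumc s : s <= k -> \sum_(t < s) (c t.+1 - c t) = c s.
  by move=> sk; rewrite -(sum_increments cS sk) c0.
have mn (t : 'I_k) : c t.+1 - c t < n.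
  have k0 : 0 < k by lia.
  have k1 : k.-1 < k by lia.
  have := sumc k (leqnn _); rewrite ck (bigD1 t) //=.
  have [t0|t0] := posnP t.
    rewrite (bigD1 (Ordinal k1)) /=; last by rewrite -(inj_eq val_inj) /=; lia.
    by have := cS _ k1; lia.
  rewrite (bigD1 (Ordinal k0)) /=; last by rewrite -(inj_eq val_inj) /=; lia.
  by have := cS _ k0; lia.
have ex (t : 'I_k) : { pi : 'S_(c t.+1 - c t) | blockwise_simple pi /\
    forall a b, value_interval pi a b <-> E (c t + a) (c t + b) /\ b <= c t.+1 - c t }.
  apply: cid; have ct := cS t (ltn_ord t).
  have Gt : admissible (c t.+1 - c t) (fun a b => E (c t + a) (c t + b) /\ b <= c t.+1 - c t).
    by apply: (admissible_shift G); [lia|rewrite subnKC 1?ltnW //; apply: cE].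
  by have [||pi] := IH _ _ _ _ Gt; [have := mn t; lia|lia|exists pi].
have [sigma sS] := exists_simple k4.
(* Intervals are recorded by values, and block [i] has rank [sigma i] in value, so it realizes child
   number [sigma i]. *)
pose m (i : 'I_k) := c (sigma i).+1 - c (sigma i).
pose alpha (i : 'I_k) : 'S_(m i) := projT1 (ex (sigma i)).
have aS i : blockwise_simple (alpha i) by case: (projT2 (ex (sigma i))).
have aE i a b : value_interval (alpha i) a b <-> E (c (sigma i) + a) (c (sigma i) + b) /\ b <= m i.
  by case: (projT2 (ex (sigma i))).
have voE i : block_offset m sigma i = c (sigma i).
  rewrite -(sumc _ (ltnW (ltn_ord _))) (big_ord_widen k (fun t => c t.+1 - c t)); last first.
    exact: ltnW.
  by rewrite (reindex_inj (@perm_inj _ sigma)).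
have nE : \sum_(i < k) m i = n.
  by rewrite -ck -(sumc _ (leqnn k)) [RHS](reindex_inj (@perm_inj _ sigma)).
have m0 i : 0 < m i by have := cS _ (ltn_ord (sigma i)); rewrite /m; lia.
have [pi piE] : exists pi : 'S_n, one_line pi = inflation sigma alpha.
  by rewrite -nE; exact: inflation_perm.
exists pi; first exact: (blockwise_simple_inflation k4 sS m0 aS piE).
move=> a b; rewrite (inflation_intervalP k4 sS m0 piE).
split=> [[[-> ->]|[t [a' [b' [/aE[H _] -> ->]]]]]|ab].
- exact: (admissible_root G).
- by rewrite !voE.
have [?|nab] := pselect (a = 0 /\ b = n); [by left|right].
have [t tk [ta tb]] := cE' _ _ ab nab; have abd := admissible_bound G ab.
exists ((sigma^-1)%g (Ordinal tk)), (a - c t), (b - c t).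
rewrite voE permKV /= !subnKC //; last lia.
by split=> //; apply/aE; rewrite /m permKV /= !subnKC //; [split=> //; lia|lia].
Qed.

(** * Convex polygons *)

Import Order.TTheory GRing.Theory Num.Theory.
Import numFieldNormedType.Exports.

Local Open Scope classical_set_scope.
Local Open Scope ring_scope.

Section Orient.
Variable R : realType.
Implicit Types o p q r x y z e a b c : R * R.

Lemma orientC p q r : orient q p r = - orient p q r.
Proof. by rewrite /orient; ring. Qed.

Lemma orient_rot p q r : orient q r p = orient p q r.
Proof. by rewrite /orient; ring. Qed.

Lemma orient_l p q : orient p q p = 0.
Proof. by rewrite /orient; ring. Qed.

Lemma orient_r p q : orient p q q = 0.
Proof. by rewrite /orient; ring. Qed.

Lemma orient_affine p q x y (t : R) :
  orient p q ((1 - t) *: x + t *: y) = (1 - t) * orient p q x + t * orient p q y.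
Proof. by rewrite /orient /= /GRing.scale /=; ring. Qed.

(* The directions from [o] within the half-plane to the left of [oe] are      *)
(* linearly ordered by angle.                                                 *)
Lemma orient_trans o e a b c : 0 <= orient o e a -> 0 < orient o e b ->
  0 < orient o e c -> 0 < orient o a b -> 0 < orient o b c -> 0 < orient o a c.
Proof.
move=> ea eb ec ab bc; rewrite -(pmulr_rgt0 _ eb).
have -> : orient o e b * orient o a c =
    orient o a b * orient o e c + orient o b c * orient o e a.
  by rewrite /orient; ring.
by rewrite ltr_wpDr ?mulr_gt0 // mulr_ge0 // ltW.
Qed.

(** The first factors on the right are barycentric coordinates of [x] in [abc], up to the factor
    [orient a b c], and [orient p q] is affine. *)
Lemma orient_barycentric a b c p q x :
  orient a b c * orient p q x =
  orient b c x * orient p q a + orient c a x * orient p q b + orient a b x * orient p q c.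
Proof. by rewrite /orient; ring. Qed.

Lemma orient_continuous p q : continuous (orient p q).
Proof.
move=> z; rewrite /orient; apply: cvgB.
  apply: cvgM; first exact: cvg_cst.
  by apply: cvgB; [exact: cvg_snd|exact: cvg_cst].
apply: cvgM; first exact: cvg_cst.
by apply: cvgB; [exact: cvg_fst|exact: cvg_cst].
Qed.

Lemma star_connected (A : set (R * R)) p : A p ->
  (forall q (t : R), A q -> 0 <= t <= 1 -> A ((1 - t) *: p + t *: q)) -> connected A.
Proof.
move=> Ap H; pose s q (t : R) : R * R := (1 - t) *: p + t *: q.
have -> : A = \bigcup_(q in A) (s q @` `[0, 1]).
  apply/seteqP; split=> [q Aq|_ [q Aq [t + <-]]].
    exists q => //; exists 1; first by rewrite /= in_itv /= ler01 lexx.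
    by rewrite /s subrr scale0r add0r scale1r.
  by rewrite /= in_itv /= => t01; apply: H.
apply: bigcup_connected.
  exists p => q Aq; exists 0; first by rewrite /= in_itv /= lexx ler01.
  by rewrite /s subr0 scale1r scale0r addr0.
move=> q Aq; apply: connected_continuous_connected; first exact: segment_connected.
apply: continuous_subspaceT => t; rewrite /s; apply: cvgD.
  apply: cvgZr_tmp; apply: cvgB; [exact: cvg_cst|exact: cvg_id].
by apply: cvgZr_tmp; exact: cvg_id.
Qed.

Lemma connected_orient_sign (C : set (R * R)) p q x y : connected C -> C x -> C y ->
  (forall z, C z -> orient p q z != 0) -> 0 < orient p q x * orient p q y.
Proof.
move=> Cc Cx Cy H; rewrite ltNge; apply/negP => xy.
have /connected_intervalP I : connected (orient p q @` C).
  apply: connected_continuous_connected => //.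
  by apply: continuous_subspaceT; exact: orient_continuous.
have [z Cz] : (orient p q @` C) 0.
  have Ix : (orient p q @` C) (orient p q x) by exists x.
  have Iy : (orient p q @` C) (orient p q y) by exists y.
  have := H x Cx; have := H y Cy => hy hx.
  have [x0|x0] := leP (orient p q x) 0.
    by apply: (I _ _ Ix Iy); rewrite x0 /=; nra.
  by apply: (I _ _ Iy Ix); rewrite (ltW x0) andbT; nra.
by move/eqP; apply/negP; exact: H.
Qed.

End Orient.

Section Polygon.
Variables (R : realType) (n : nat) (v : 'I_n.+1 -> R * R).
Hypothesis n2 : (2 <= n)%N.
Hypothesis v_convex : convex_polygon v.

Definition vertex (i : nat) : R * R := v (inord i).
Local Notation V := vertex.

Lemma vertex_ord (i : 'I_n.+1) : V i = v i.
Proof. by rewrite /vertex inord_val. Qed.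

Lemma ordS_inord i : (i < n)%N -> ordS (inord i : 'I_n.+1) = inord i.+1.
Proof.
move=> i_n; apply: val_inj; rewrite /= !inordK ?modn_small //; lia.
Qed.

Lemma ordS_inord_last : ordS (inord n : 'I_n.+1) = inord 0.
Proof. by apply: val_inj; rewrite /= !inordK ?modnn. Qed.

Lemma inord_neq i j : (i <= n)%N -> (j <= n)%N -> i != j -> inord i != inord j :> 'I_n.+1.
Proof. by move=> ? ?; apply: contra => /eqP/(congr1 val)/=; rewrite !inordK // => ->. Qed.

Lemma orient_side i j : (i < n)%N -> (j <= n)%N -> j != i -> j != i.+1 ->
  0 < orient (V i) (V i.+1) (V j).
Proof.
move=> i_n jn ji jSi; rewrite /vertex -ordS_inord //; apply: v_convex.
  by apply: inord_neq => //; lia.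
by rewrite ordS_inord //; apply: inord_neq => //; lia.
Qed.

Lemma orient_last_side j : (0 < j < n)%N -> 0 < orient (V n) (V 0) (V j).
Proof.
move=> /andP[j0 jn]; rewrite /vertex -ordS_inord_last; apply: v_convex.
  by apply: inord_neq => //; lia.
by rewrite ordS_inord_last; apply: inord_neq => //; lia.
Qed.

(** Convexity is given along sides only; induction on [k] extends it by sorting the directions
    around [V i] with [orient_trans], the side to [V i.+1] being the reference. *)
Lemma orient_pos i j k : (i < j < k)%N -> (k <= n)%N -> 0 < orient (V i) (V j) (V k).
Proof.
elim: k => [|k IH] /andP[ij jk] kn; first by lia.
have [kj|kj] := eqVneq k j; first by subst j; rewrite -orient_rot; apply: orient_side; lia.
apply: (@orient_trans _ _ (V i.+1) _ (V k)).
- have [->|ji] := eqVneq j i.+1; first by rewrite orient_r.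
  by apply/ltW/orient_side; lia.
- by apply: orient_side; lia.
- by apply: orient_side; lia.
- by apply: IH; lia.
- by rewrite -orient_rot; apply: orient_side; lia.
Qed.

Lemma orient_inside x y z : (x < z < y)%N -> (y <= n)%N -> orient (V x) (V y) (V z) < 0.
Proof.
by move=> xzy yn; rewrite orient_rot orientC oppr_lt0; apply: orient_pos.
Qed.

Lemma orient_outside x y z : (x < y)%N -> (y <= n)%N -> (z <= n)%N ->
  (z < x)%N || (y < z)%N -> 0 < orient (V x) (V y) (V z).
Proof.
move=> xy yn zn /orP[zx|yz]; last by apply: orient_pos => //; lia.
by rewrite orient_rot; apply: orient_pos => //; lia.
Qed.

Lemma orient_outside_ge0 x y z : (x < y)%N -> (y <= n)%N -> (z <= n)%N ->
  (z <= x)%N || (y <= z)%N -> 0 <= orient (V x) (V y) (V z).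
Proof.
move=> xy yn zn H.
have [->|zx] := eqVneq z x; first by rewrite orient_l.
have [->|zy] := eqVneq z y; first by rewrite orient_r.
by apply/ltW/orient_outside => //; lia.
Qed.

Lemma orient_inside_le0 x y z : (x <= z <= y)%N -> (x < y)%N -> (y <= n)%N ->
  orient (V x) (V y) (V z) <= 0.
Proof.
move=> H xy yn.
have [->|zx] := eqVneq z x; first by rewrite orient_l.
have [->|zy] := eqVneq z y; first by rewrite orient_r.
by apply/ltW/orient_inside => //; lia.
Qed.

Lemma orient_eq0 x y z : (x < y)%N -> (y <= n)%N -> (z <= n)%N ->
  (orient (V x) (V y) (V z) == 0) = (z == x) || (z == y).
Proof.
move=> xy yn zn.
have [->|zx] := eqVneq z x; first by rewrite orient_l eqxx.
have [->|zy] := eqVneq z y; first by rewrite orient_r eqxx.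
case: (boolP (x < z < y)%N) => H; first by rewrite lt_eqF // orient_inside.
by rewrite gt_eqF // orient_outside //; lia.
Qed.

Lemma polygon_interiorP p : polygon_interior v p <->
  (forall i, (i < n)%N -> 0 < orient (V i) (V i.+1) p) /\ orient (V 0) (V n) p < 0.
Proof.
split=> [H|[H H0] i].
  split=> [i i_n|]; first by rewrite /vertex -ordS_inord.
  by rewrite orientC oppr_lt0 /vertex -ordS_inord_last.
rewrite -vertex_ord; have [i_n|i_n] := ltnP i n.
  have -> : ordS i = inord i.+1 by rewrite -ordS_inord // inord_val.
  exact: H.
have -> : i = inord n by apply: val_inj; rewrite /= inordK //; have := ltn_ord i; lia.
rewrite ordS_inord_last inordK // -/(vertex 0) orientC oppr_gt0 //.
Qed.

Section Under.
Variable p : R * R.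
Hypothesis p_int : polygon_interior v p.

Lemma interior_side i : (i < n)%N -> 0 < orient (V i) (V i.+1) p.
Proof. by have [H _] := (polygon_interiorP p).1 p_int; apply: H. Qed.

Lemma interior_last_side : 0 < orient (V n) (V 0) p.
Proof. by have [_ H] := (polygon_interiorP p).1 p_int; rewrite orientC oppr_gt0. Qed.

(** A negative [orient (V c) (V d) p] means that [p] is under the chord, on the side of the vertices
    strictly between [c] and [d]. The directions from [V d] to [V x], [V c] and [p] come in this
    order, so [orient_trans] applies, with the side leaving [V d] as reference. *)
Lemma under_left x c d : (x <= c < d)%N -> (d <= n)%N ->
  orient (V c) (V d) p < 0 -> orient (V x) (V d) p < 0.
Proof.
move=> /andP[xc cd] dn; have [->//|xNc] := eqVneq x c.
rewrite orientC oppr_lt0 => cdp; rewrite orientC oppr_lt0.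
have xcd : 0 < orient (V d) (V x) (V c) by rewrite -orient_rot; apply: orient_pos => //; lia.
have [dn'|dn'] := ltnP d n.
  apply: (@orient_trans _ _ (V d.+1) _ (V c)) => //.
  - by apply/ltW/orient_side => //; lia.
  - by apply: orient_side => //; lia.
  - exact: interior_side.
have dE : d = n by lia.
subst d; apply: (@orient_trans _ _ (V 0) _ (V c)) => //.
- have [->|x0] := eqVneq x 0; first by rewrite orient_r.
  by apply/ltW/orient_last_side; lia.
- by apply: orient_last_side; lia.
- exact: interior_last_side.
Qed.

Lemma under_right c d y : (c < d <= y)%N -> (y <= n)%N ->
  orient (V c) (V d) p < 0 -> orient (V c) (V y) p < 0.
Proof.
move=> /andP[cd dy] yn; have [<-//|dNy] := eqVneq d y.
rewrite orient_rot orientC oppr_lt0 => cdp; rewrite orient_rot orientC oppr_lt0.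
have cn : (c < n)%N by lia.
have dc : d != c.+1.
  apply: contraTneq cdp => ->.
  by rewrite orient_rot orientC oppr_gt0 -leNgt ltW // interior_side.
apply: (@orient_trans _ _ (V c.+1) _ (V d)) => //.
- exact/ltW/interior_side.
- by apply: orient_side => //; lia.
- by apply: orient_side => //; lia.
- by apply: orient_pos => //; lia.
Qed.

Lemma under_sub x c d y : (x <= c < d)%N -> (d <= y <= n)%N ->
  orient (V c) (V d) p < 0 -> orient (V x) (V y) p < 0.
Proof.
move=> xcd dyn cdp; apply: (@under_right x d); [lia|lia|].
by apply: (@under_left x c); [lia|lia|].
Qed.

(** Otherwise [p] is also under [(a, c)], and the order of the directions around [V c] would put
    [V d] on the wrong side of [(a, c)]. *)
Lemma under_disjoint a b c d : (a < b <= c)%N -> (c < d <= n)%N ->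
  orient (V a) (V b) p < 0 -> 0 <= orient (V c) (V d) p.
Proof.
move=> abc cdn abp; rewrite leNgt; apply/negP => cdp.
have acp : orient (V a) (V c) p < 0 by apply: (@under_right a b); [lia|lia|].
have dc : d != c.+1.
  by apply: contraTneq cdp => ->; rewrite -leNgt ltW // interior_side //; lia.
suff : 0 < orient (V c) (V a) (V d).
  by rewrite orientC oppr_gt0 ltNge ltW // orient_pos //; lia.
apply: (@orient_trans _ _ (V c.+1) _ p).
- by apply/ltW/orient_side; lia.
- by apply: interior_side; lia.
- by apply: orient_side; lia.
- by rewrite orientC oppr_gt0.
- by rewrite orient_rot orientC oppr_gt0.
Qed.

End Under.
End Polygon.

(** * Diagonals and regions *)

(** The sides, with [(0, n)] among them, are added to [D] because they correspond to the trivial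
    intervals, which every permutation has. *)
Definition chord n (D : {set 'I_n.+1 * 'I_n.+1}) (a b : nat) : Prop :=
  [\/ b = a.+1 /\ (a < n)%N, a = 0%N /\ b = n
    | exists2 d, d \in D & a = d.1 :> nat /\ b = d.2 :> nat].

Lemma is_diagonalP n (d : 'I_n.+1 * 'I_n.+1) :
  is_diagonal d <-> (d.1.+1 < d.2)%N /\ ~ (d.1 = 0 :> nat /\ d.2 = n :> nat).
Proof.
case: d => [[i i_n] [j jn]]; rewrite /is_diagonal /= -!(inj_eq val_inj) /=.
have sE x : (x < n.+1)%N -> (x.+1 %% n.+1)%N = (if x == n then 0 else x.+1)%N.
  by move=> xn; case: eqP => [->|?]; [rewrite modnn|rewrite modn_small; lia].
rewrite !sE //; case: (i =P n) => hi; case: (j =P n) => hj; lia.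
Qed.

Section Diagonals.
Variables (R : realType) (n : nat) (v : 'I_n.+1 -> R * R).
Hypothesis n2 : (2 <= n)%N.
Hypothesis v_convex : convex_polygon v.
Local Notation V := (vertex v).

Lemma interior_on_line d p : is_diagonal d -> polygon_interior v p ->
  orient (v d.1) (v d.2) p = 0 ->
  exists2 t : R, 0 < t < 1 & p = (1 - t) *: v d.1 + t *: v d.2.
Proof.
move=> /is_diagonalP[d12 d0n] p_int onl.
have d2n := ltn_ord d.2.
rewrite -!vertex_ord in onl *.
set P := V d.1 in onl *; set Q := V d.2 in onl *; set e := V (d.1).+1.
have K : 0 < orient P e Q by apply: orient_side => //; lia.
have L : 0 < orient P e p by apply: interior_side => //; lia.
(* [t] is the ratio of the distances of [p] and [Q] to the side leaving [P]; the bound [t < 1] comes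
   from the side leaving [Q]. *)
pose t := orient P e p / orient P e Q.
have pE : p = (1 - t) *: P + t *: Q.
  have K0 := lt0r_neq0 K.
  have tK : t * orient P e Q = orient P e p by rewrite /t divfK.
  apply: injective_projections; rewrite /= /GRing.scale /=.
    apply: (mulfI K0).
    have -> : orient P e Q * ((1 - t) * P.1 + t * Q.1) =
      orient P e Q * P.1 + (t * orient P e Q) * (Q.1 - P.1) by ring.
    rewrite tK; apply/eqP; rewrite -subr_eq0; apply/eqP.
    transitivity (- orient P Q p * (e.1 - P.1)); last by rewrite onl; ring.
    by rewrite /orient; ring.
  apply: (mulfI K0).
  have -> : orient P e Q * ((1 - t) * P.2 + t * Q.2) =
    orient P e Q * P.2 + (t * orient P e Q) * (Q.2 - P.2) by ring.
  rewrite tK; apply/eqP; rewrite -subr_eq0; apply/eqP.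
  transitivity (- orient P Q p * (e.2 - P.2)); last by rewrite onl; ring.
  by rewrite /orient; ring.
exists t => //; rewrite divr_gt0 //=.
have [f fP fp] : exists2 f, 0 < orient Q f P & 0 < orient Q f p.
  have [d2|d2] := ltnP d.2 n.
    exists (V (d.2).+1); first by apply: orient_side => //; lia.
    exact: interior_side.
  exists (V 0); rewrite /Q; have -> : (d.2 : nat) = n by lia.
    by apply: orient_last_side => //; lia.
  exact: interior_last_side.
move: fp; rewrite pE orient_affine orient_l mulr0 addr0 pmulr_lgt0 // subr_gt0.
by [].
Qed.

Lemma segment_on_line d p : diagonal_segment v d p -> orient (v d.1) (v d.2) p = 0.
Proof. by case=> t _ ->; rewrite orient_affine orient_l orient_r !mulr0 addr0. Qed.

Lemma combination_gt0 (t x y : R) : 0 < t < 1 -> 0 <= x -> 0 <= y ->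
  (x != 0) || (y != 0) -> 0 < (1 - t) * x + t * y.
Proof.
move=> t01 x0 y0 /orP[xn|yn].
  have : 0 < x by rewrite lt_neqAle eq_sym xn.
  nra.
have : 0 < y by rewrite lt_neqAle eq_sym yn.
nra.
Qed.

Lemma diagonal_point_interior d (t : R) : is_diagonal d -> 0 < t < 1 ->
  polygon_interior v ((1 - t) *: v d.1 + t *: v d.2).
Proof.
move=> /is_diagonalP[d12 d0n] t01; have d2n := ltn_ord d.2; have d1n := ltn_ord d.1.
apply/polygon_interiorP => //; rewrite -!vertex_ord; split=> [i i_n|].
  rewrite orient_affine; apply: combination_gt0 => //.
  - by apply: orient_outside_ge0 => //; lia.
  - by apply: orient_outside_ge0 => //; lia.
  - by rewrite !orient_eq0 //; lia.
rewrite -oppr_gt0 -orientC orient_affine; apply: combination_gt0 => //.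
- by rewrite orientC oppr_ge0; apply: orient_inside_le0 => //; lia.
- by rewrite orientC oppr_ge0; apply: orient_inside_le0 => //; lia.
- by rewrite ![orient (V n) _ _]orientC !oppr_eq0 !orient_eq0 //; lia.
Qed.

Lemma crossing d e : is_diagonal d -> is_diagonal e ->
  (d.1 < e.1 < d.2)%N -> (d.2 < e.2)%N -> ~ noncrossing v d e.
Proof.
move=> dd de lt1 lt2; have e2n := ltn_ord e.2.
have A : 0 < orient (v e.1) (v e.2) (v d.1).
  by rewrite -!vertex_ord; apply: orient_outside => //; lia.
have B : orient (v e.1) (v e.2) (v d.2) < 0.
  by rewrite -!vertex_ord; apply: orient_inside => //; lia.
move: A B; set a := orient _ _ (v d.1); set b := orient _ _ (v d.2) => A B.
have ab : 0 < a - b by lra.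
(* The zero along [d] of the affine function [orient (v e.1) (v e.2)]. *)
pose t := a / (a - b).
have t01 : 0 < t < 1 by rewrite divr_gt0 //= ltr_pdivrMr //; lra.
have p_int := diagonal_point_interior dd t01.
have tab : t * (a - b) = a by rewrite /t divfK // lt0r_neq0.
have [|s s01 pE] := interior_on_line de p_int.
  by rewrite orient_affine -/a -/b; lra.
rewrite /noncrossing => H; suff : set0 ((1 - t) *: v d.1 + t *: v d.2) by [].
rewrite -H; split=> //; split; first by exists t => //; lra.
by exists s => //; lra.
Qed.

(** The ends of [d] lie weakly on one side of the line of [e], and not both on it, so no point
    strictly between them is on that line. *)
Lemma uncrossed d e : is_diagonal d -> is_diagonal e -> d != e ->
  ~~ ((d.1 < e.1 < d.2) && (d.2 < e.2))%N -> ~~ ((e.1 < d.1 < e.2) && (e.2 < d.2))%N ->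
  noncrossing v d e.
Proof.
move=> dd de dNe nc1 nc2; apply/seteqP; split=> // p [[sd se] p_int].
have [t t01 pE] := interior_on_line dd p_int (segment_on_line sd).
have := segment_on_line se; rewrite pE orient_affine -!vertex_ord.
have d2n := ltn_ord d.2; have e2n := ltn_ord e.2.
move/is_diagonalP: dd => [d12 _]; move/is_diagonalP: de => [e12 _].
have nz : (orient (V e.1) (V e.2) (V d.1) != 0) || (orient (V e.1) (V e.2) (V d.2) != 0).
  rewrite !orient_eq0 //; try lia.
  have : ~ (d.1 = e.1 :> nat /\ d.2 = e.2 :> nat).
    case=> /val_inj h1 /val_inj h2; move/eqP: dNe; apply.
    by apply: injective_projections.
  lia.
case: (boolP ((d.1 <= e.1) || (e.2 <= d.1))%N) => h1.
  case: (boolP ((d.2 <= e.1) || (e.2 <= d.2))%N) => h2.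
    apply/eqP; rewrite gt_eqF // combination_gt0 // orient_outside_ge0 //; lia.
  have -> : (d.1 : nat) = e.1 by lia.
  rewrite orient_l mulr0 add0r; apply/eqP; rewrite lt_eqF //.
  by rewrite pmulr_rlt0 ?orient_inside //; lra || lia.
have le1 : orient (V e.1) (V e.2) (V d.1) <= 0 by apply: orient_inside_le0 => //; lia.
have le2 : orient (V e.1) (V e.2) (V d.2) <= 0 by apply: orient_inside_le0 => //; lia.
move/eqP; rewrite -oppr_eq0 opprD -!mulrN; apply/negP; rewrite gt_eqF //.
by apply: combination_gt0; rewrite ?oppr_ge0 ?oppr_eq0.
Qed.

Section Cell.
Variable D : {set 'I_n.+1 * 'I_n.+1}.
Hypothesis D_diag : forall d, d \in D -> is_diagonal d.
Local Notation E := (chord D).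

Lemma chord_bound a b : E a b -> (a < b <= n)%N.
Proof.
case=> [[-> ?]|[-> ->]|[d dD [-> ->]]]; [lia|lia|].
have /is_diagonalP[d12 _] := D_diag dD; have := ltn_ord d.2.
by rewrite ltnS => ->; rewrite andbT ltnW.
Qed.

Definition cell p : set (R * R) :=
  [set q | forall a b, E a b -> 0 < orient (V a) (V b) p * orient (V a) (V b) q].

Lemma complement_neq0 q a b : diagonals_complement v D q -> E a b ->
  orient (V a) (V b) q != 0.
Proof.
move=> [q_int qD] [[-> an]|[-> ->]|[d dD [-> ->]]].
- by rewrite gt_eqF // interior_side.
- by rewrite orientC oppr_eq0 gt_eqF // interior_last_side.
rewrite !vertex_ord; apply/eqP => H; apply: qD; exists d => //.
by have [t t01 ->] := interior_on_line (D_diag dD) q_int H; exists t => //; lra.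
Qed.

Lemma complementP q : polygon_interior v q ->
  (forall a b, E a b -> orient (V a) (V b) q != 0) -> diagonals_complement v D q.
Proof.
move=> q_int H; split=> // -[d dD /segment_on_line]; rewrite -!vertex_ord.
by apply/eqP/H; apply: Or33; exists d.
Qed.

Lemma cell_interior p q : polygon_interior v p -> cell p q -> polygon_interior v q.
Proof.
move=> p_int pq; apply/polygon_interiorP => //; split=> [i i_n|].
  have /pq : E i i.+1 by apply: Or31.
  by rewrite pmulr_rgt0 // interior_side.
have /pq : E 0 n by apply: Or32.
by rewrite [_ _ _ p]orientC mulNr oppr_gt0 pmulr_rlt0 // interior_last_side.
Qed.

(** A connected set that avoids the line of each chord stays on one side of it; conversely the cell
    is star-shaped around [p] and avoids the diagonals. *)
Lemma component_cell p : diagonals_complement v D p ->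
  connected_component (diagonals_complement v D) p = cell p.
Proof.
move=> pD; have [p_int _] := pD; apply/seteqP; split=> [q Cq a b ab|].
  apply: (connected_orient_sign (C := connected_component (diagonals_complement v D) p)) => //.
  - exact: component_connected.
  - exact: connected_component_refl.
  - by move=> z /connected_component_sub zD; exact: complement_neq0 zD ab.
have cpp : cell p p by move=> a b /(complement_neq0 pD) h; rewrite -expr2 exprn_even_gt0.
apply: connected_component_max => //.
- move=> q pq; apply: complementP; first exact: cell_interior pq.
  by move=> a b /pq; apply: contraTneq => ->; rewrite mulr0 ltxx.
- apply: (@star_connected _ _ p) => // q t pq t01 a b ab.
  have cp := cpp.
  rewrite orient_affine mulrDr ![orient _ _ p * (_ * _)]mulrCA.
  have := cp a b ab; have := pq a b ab; move: (_ * _) (_ * _) => x y x0 y0.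
  have [->|tn1] := eqVneq t 1; first by rewrite subrr mul0r add0r mul1r.
  by rewrite ltr_pwDl ?mulr_gt0 ?mulr_ge0 // ?(ltW x0); lra.
Qed.

End Cell.
End Diagonals.

(** * Regions of an admissible family have at least five sides *)

Section Regions.
Variables (R : realType) (n : nat) (v : 'I_n.+1 -> R * R).
Hypothesis n2 : (2 <= n)%N.
Hypothesis v_convex : convex_polygon v.
Local Notation V := (vertex v).
Variable D : {set 'I_n.+1 * 'I_n.+1}.
Hypothesis D_diag : forall d, d \in D -> is_diagonal d.
Local Notation E := (chord D).

Let bd := chord_bound n2 D_diag.

Lemma midpoint_onem : 1 - 2^-1 = 2^-1 :> R.
Proof. by lra. Qed.

Definition mid (x y : R * R) : R * R := (1 - 2^-1) *: x + 2^-1 *: y.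

Lemma orient_mid p q x y : orient p q (mid x y) = (orient p q x + orient p q y) / 2.
Proof. by rewrite orient_affine midpoint_onem; lra. Qed.

Section RegionSides.
Variables (p : R * R) (E_adm : admissible n E).
Hypothesis pD : diagonals_complement v D p.

Let p_int : polygon_interior v p. Proof. by case: pD. Qed.

Lemma exists_minimal_chord : exists a b, [/\ E a b, orient (V a) (V b) p < 0 &
  forall c e, E c e -> (e - c < b - a)%N -> 0 <= orient (V c) (V e) p].
Proof.
pose Q l := `[< exists a, E a (a + l)%N /\ orient (V a) (V (a + l)) p < 0 >].
have exQ : exists l, Q l.
  exists n; apply/asboolP; exists 0%N; rewrite add0n; split; first by apply: Or32.
  by rewrite orientC oppr_lt0 interior_last_side.
have [l /asboolP[a [al lt0]] lmin] := ex_minnP exQ.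
exists a, (a + l)%N; split=> // c e ce lt; have := bd ce => cen.
rewrite leNgt; apply/negP => ce0; have := lmin (e - c)%N.
suff -> : Q (e - c)%N by move=> /(_ isT); lia.
by apply/asboolP; exists c; rewrite subnKC; [|lia].
Qed.

(* The shortest chord (a, b) separating [p] from the vertices outside [a, b], *)
(* together with the first four of the maximal chords below it.               *)
Lemma child_sides : exists e : seq (nat * nat), [/\ uniq e, size e = 5,
  forall x y, (x, y) \in e -> E x y &
  forall x y, (x, y) \in e -> forall c d, E c d ->
    0 <= orient (V c) (V d) p * orient (V c) (V d) (V x) /\
    0 <= orient (V c) (V d) p * orient (V c) (V d) (V y)].
Proof.
have [a [b [ab ab0 abmin]]] := exists_minimal_chord.
have abn := bd ab.
have side_ge0 x : (x < n)%N -> 0 < orient (V x) (V x.+1) p by exact: interior_side.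
have ba : b <> a.+1.
  by move=> e; move: ab0; rewrite e ltNge ltW // side_ge0; lia.
(* A free vertex is strictly inside no chord below [(a, b)] but [(a, b)] itself; the longest such
   chord leaving a free vertex ends at a free one. *)
pose free x := forall c d, E c d -> (a <= c)%N -> (d <= b)%N -> ~ (c = a /\ d = b) ->
  ~ (c < x < d)%N.
have step x : (a <= x < b)%N -> free x -> exists y, [/\ (x < y <= b)%N, E x y,
    ~ (x = a /\ y = b) & free y].
  move=> axb fx; pose Q y := (y <= b)%N && `[< E x y /\ ~ (x = a /\ y = b) >].
  have exQ : exists y, Q y.
    exists x.+1; apply/andP; split; first lia.
    by apply/asboolP; split; [apply: Or31; lia|lia].
  have bdQ y : Q y -> (y <= b)%N by case/andP.
  have [y /andP[yb /asboolP[xy nxy]] ymax] := ex_maxnP exQ bdQ.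
  exists y; split=> //; first by have := bd xy; lia.
  move=> c d cd ac db ncd /andP[cy yd]; have [cx|cx|cx] := ltngtP c x.
  - by apply: (fx c d cd ac db ncd); have := bd xy; lia.
  - exact: (admissible_laminar E_adm xy cd).
  - subst c; have := ymax d; rewrite leqNgt yd /Q db /=.
    by move=> H; suff: false by []; apply: H; apply/asboolP.
have fa : free a by move=> c d _ ac _ _; lia.
have fb : free b by move=> c d _ _ db _; lia.
have [|x1 [x1b e1 ne1 f1]] := step a _ fa; first lia.
have [|x2 [x2b e2 ne2 f2]] := step x1 _ f1; first lia.
(* Reaching [b] at [x2] or [x3] would close a triangle or a quadrilateral, so there is a fourth
   chord. *)
have x2b' : x2 <> b by move=> e; subst x2; exact: (admissible_triangle E_adm e1 e2 ab).
have [|x3 [x3b e3 ne3 f3]] := step x2 _ f2; first lia.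
have x3b' : x3 <> b by move=> e; subst x3; exact: (admissible_quadrilateral E_adm e1 e2 e3 ab).
have [|x4 [x4b e4 ne4 f4]] := step x3 _ f3; first lia.
(* Chords beside [(a, b)] or properly below it have both [p] and [V z] weakly outside; chords that
   contain [(a, b)] have both weakly under. *)
have key z : (a <= z <= b)%N -> free z -> forall c d, E c d ->
    0 <= orient (V c) (V d) p * orient (V c) (V d) (V z).
  move=> azb fz c d cd; have cdn := bd cd.
  case: (boolP (a <= c)%N) => ac; last first.
    case: (leqP d a) => da.
      apply: mulr_ge0; last by apply: orient_outside_ge0 => //; lia.
      rewrite leNgt; apply/negP => cd0.
      by have := under_disjoint n2 v_convex p_int _ _ cd0 => /(_ a b); rewrite leNgt ab0; lia.
    have bld : (b <= d)%N.
      by rewrite leqNgt; apply/negP => ?; apply: (admissible_laminar E_adm cd ab); lia.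
    apply: mulr_le0; last by apply: orient_inside_le0 => //; lia.
    by apply/ltW; apply: (under_sub n2 v_convex p_int _ _ ab0); lia.
  case: (leqP d b) => db; last first.
    case: (leqP b c) => bc.
      apply: mulr_ge0; last by apply: orient_outside_ge0 => //; lia.
      by apply: (under_disjoint n2 v_convex p_int _ _ ab0); lia.
    have ca : c = a.
      apply/eqP; rewrite eqn_leq ac andbT leqNgt; apply/negP => ?.
      by apply: (admissible_laminar E_adm ab cd); lia.
    apply: mulr_le0; last by apply: orient_inside_le0 => //; lia.
    by apply/ltW; apply: (under_sub n2 v_convex p_int _ _ ab0); lia.
  have [[-> ->]|ncd] := pselect (c = a /\ d = b).
    by apply: mulr_le0; [exact: ltW|apply: orient_inside_le0 => //; lia].
  apply: mulr_ge0; first by apply: abmin => //; lia.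
  by apply: orient_outside_ge0 => //; have := fz c d cd ac db ncd; lia.
exists [:: (a, x1); (x1, x2); (x2, x3); (x3, x4); (a, b)]; split=> //.
- by rewrite /= !inE !xpair_eqE; lia.
- by move=> x y; rewrite !inE !xpair_eqE => /or4P[| | |/orP[]] /andP[/eqP -> /eqP ->].
move=> x y xy c d cd; suff [[xb fx] [yb fy]] :
    ((a <= x <= b)%N /\ free x) /\ ((a <= y <= b)%N /\ free y).
  by split; apply: key.
by move: xy; rewrite !inE !xpair_eqE => /or4P[| | |/orP[]] /andP[/eqP -> /eqP ->];
  split; split=> //; lia.
Qed.

(** The midpoints of the five sides are on the boundary of the cell, so each lies on the line of a
    side of [w]. With fewer than five lines, two midpoints share one, and so does their average,
    which is inside the cell. *)
Lemma cell_not_small k (w : 'I_k -> R * R) : (k < 5)%N ->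
  cell v D p <> polygon_interior w.
Proof.
move=> k5 cellE; have [e [e_uniq e_size eE e_sgn]] := child_sides.
have s0 c d : E c d -> orient (V c) (V d) p != 0.
  exact: (complement_neq0 n2 v_convex D_diag pD).
pose M (xy : nat * nat) := mid (V xy.1) (V xy.2).
have M_ge0 xy c d : xy \in e -> E c d -> 0 <= orient (V c) (V d) p * orient (V c) (V d) (M xy).
  case: xy => x y xy cd; have [h1 h2] := e_sgn _ _ xy c d cd.
  by rewrite orient_mid mulrA mulrDr; lra.
(* The average fails to be inside only if some chord line contains both midpoints; it then contains
   the ends of both sides, so the two sides coincide. *)
have M_avg xy xy' : xy \in e -> xy' \in e -> xy != xy' -> cell v D p (mid (M xy) (M xy')).
  move=> xye xye' ne c d cd; rewrite orient_mid mulrA mulrDr.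
  have := M_ge0 _ _ _ xye cd; have := M_ge0 _ _ _ xye' cd => g1 g2.
  rewrite divr_gt0 // lt_neqAle addr_ge0 // andbT eq_sym paddr_eq0 //.
  apply: contra ne => /andP[]; rewrite !mulf_eq0 !(negbTE (s0 _ _ cd)) /=.
  case: xy xye g2 => x y xye _; case: xy' xye' g1 => x' y' xye' _.
  have [h1 h2] := e_sgn _ _ xye c d cd; have [h1' h2'] := e_sgn _ _ xye' c d cd.
  have cdn := bd cd; have xyn := bd (eE _ _ xye); have xyn' := bd (eE _ _ xye').
  have aux u z : 0 <= orient (V c) (V d) p * orient (V c) (V d) (V u) ->
      0 <= orient (V c) (V d) p * orient (V c) (V d) (V z) ->
      orient (V c) (V d) (M (u, z)) = 0 ->
      orient (V c) (V d) (V u) = 0 /\ orient (V c) (V d) (V z) = 0.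
    move=> hu hz; rewrite orient_mid => /eqP; rewrite mulf_eq0 invr_eq0 pnatr_eq0 orbF => /eqP H.
    have zE : orient (V c) (V d) (V z) = - orient (V c) (V d) (V u) by lra.
    have : orient (V c) (V d) p * orient (V c) (V d) (V u) = 0.
      by apply/eqP; rewrite eq_le hu andbT; rewrite zE mulrN oppr_ge0 in hz.
    by move/eqP; rewrite mulf_eq0 (negbTE (s0 _ _ cd)) /= zE => /eqP ->; rewrite oppr0.
  move=> /eqP/aux[]// /eqP k1 /eqP k2 /eqP/aux[]// /eqP k3 /eqP k4.
  by rewrite !orient_eq0 // in k1 k2 k3 k4; rewrite ?xpair_eqE; lia.
have M_notin xy : xy \in e -> ~ cell v D p (M xy).
  case: xy => x y xye /(_ _ _ (eE _ _ xye)).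
  by rewrite orient_mid orient_l orient_r addr0 mul0r mulr0 ltxx.
have cellpp : cell v D p p by move=> c d /s0 h; rewrite -expr2 exprn_even_gt0.
(* Points strictly between a midpoint and [p] are in the cell; [t] is where [f] would vanish on the
   way. *)
have w_ge0 i xy : xy \in e -> 0 <= orient (w i) (w (ordS i)) (M xy).
  move=> xye; rewrite leNgt; apply/negP => wM.
  have wp : 0 < orient (w i) (w (ordS i)) p by move: cellpp; rewrite cellE => /(_ i).
  move: wM wp; set f := orient _ _ => wM wp.
  have fd : 0 < f p - f (M xy) by lra.
  pose t := - f (M xy) / (f p - f (M xy)).
  have t01 : 0 < t < 1.
    by rewrite divr_gt0 ?oppr_gt0 //= ltr_pdivrMr //; lra.
  have tE : t * (f p - f (M xy)) = - f (M xy) by rewrite /t divfK // lt0r_neq0.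
  have : cell v D p ((1 - t) *: M xy + t *: p).
    move=> c d cd; rewrite orient_affine mulrDr ![orient _ _ p * (_ * _)]mulrCA.
    have := M_ge0 _ _ _ xye cd; have := cellpp c d cd; move: (_ * _) (_ * _) => A B A0 B0.
    nra.
  rewrite cellE => /(_ i); rewrite orient_affine -/f; lra.
have ex (j : 'I_5) : { i | orient (w i) (w (ordS i)) (M (nth (0, 0)%N e j)) = 0 }.
  apply: cid; apply: contrapT => H.
  have je : nth (0, 0)%N e j \in e by rewrite mem_nth // e_size.
  apply: (M_notin _ je); rewrite cellE => i.
  rewrite lt_neqAle w_ge0 // andbT eq_sym; apply/eqP => H0; apply: H; by exists i.
have /injectivePn[j [j' jj' fE]] : ~~ injectiveb (fun j => projT1 (ex j)).
  by apply/negP => /injectiveP/leq_card; rewrite !card_ord; lia.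
have je : nth (0, 0)%N e j \in e by rewrite mem_nth // e_size.
have je' : nth (0, 0)%N e j' \in e by rewrite mem_nth // e_size.
have := M_avg _ _ je je'; rewrite nth_uniq ?e_size // => /(_ jj').
rewrite cellE => /(_ (projT1 (ex j))); rewrite orient_mid (projT2 (ex j)) fE.
by rewrite (projT2 (ex j')) addr0 mul0r ltxx.
Qed.

End RegionSides.
End Regions.

(** * Triangles and quadrilaterals *)

Section SmallPolygons.
Variable R : realType.
Implicit Types a b c d p q x y : R * R.

Definition triangle a b c (i : 'I_3) : R * R := nth a [:: a; b; c] i.
Definition quadrilateral a b c d (i : 'I_4) : R * R := nth a [:: a; b; c; d] i.

Lemma triangle_interiorP a b c q : polygon_interior (triangle a b c) q <->
  [/\ 0 < orient a b q, 0 < orient b c q & 0 < orient c a q].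
Proof.
split=> [H|[h1 h2 h3] [[|[|[|]]] //]].
by split; [exact: (H (@Ordinal 3 0 isT))|exact: (H (@Ordinal 3 1 isT))|
  exact: (H (@Ordinal 3 2 isT))].
Qed.

Lemma quadrilateral_interiorP a b c d q : polygon_interior (quadrilateral a b c d) q <->
  [/\ 0 < orient a b q, 0 < orient b c q, 0 < orient c d q & 0 < orient d a q].
Proof.
split=> [H|[h1 h2 h3 h4] [[|[|[|[|]]]] //]].
by split; [exact: (H (@Ordinal 4 0 isT))|exact: (H (@Ordinal 4 1 isT))|
  exact: (H (@Ordinal 4 2 isT))|exact: (H (@Ordinal 4 3 isT))].
Qed.

Lemma triangle_convex a b c : 0 < orient a b c -> convex_polygon (triangle a b c).
Proof.
move=> abc; have bca : 0 < orient b c a by rewrite orient_rot.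
have cab : 0 < orient c a b by rewrite orient_rot.
by move=> [[|[|[|]]] //= i3] [[|[|[|]]] //= j3].
Qed.

Lemma quadrilateral_convex a b c d : 0 < orient a b c -> 0 < orient a b d ->
  0 < orient a c d -> 0 < orient b c d -> convex_polygon (quadrilateral a b c d).
Proof.
move=> abc abd acd bcd.
have bca : 0 < orient b c a by rewrite orient_rot.
have cda : 0 < orient c d a by rewrite orient_rot.
have cdb : 0 < orient c d b by rewrite orient_rot.
have dab : 0 < orient d a b by rewrite -orient_rot.
have dac : 0 < orient d a c by rewrite -orient_rot.
by move=> [[|[|[|[|]]]] //= i4] [[|[|[|[|]]]] //= j4].
Qed.

Lemma triangle_pos a b c p x q : 0 < orient a b c ->
  polygon_interior (triangle a b c) q ->
  0 <= orient p x a -> 0 <= orient p x b -> 0 <= orient p x c ->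
  [|| orient p x a != 0, orient p x b != 0 | orient p x c != 0] -> 0 < orient p x q.
Proof.
move=> abc /triangle_interiorP[abq bcq caq] pa pb pc nz.
rewrite -(pmulr_rgt0 _ abc) orient_barycentric.
have ha : 0 <= orient b c q * orient p x a by rewrite mulr_ge0 // ltW.
have hb : 0 <= orient c a q * orient p x b by rewrite mulr_ge0 // ltW.
have hc : 0 <= orient a b q * orient p x c by rewrite mulr_ge0 // ltW.
rewrite lt_neqAle eq_sym !addr_ge0 // andbT !paddr_eq0 ?addr_ge0 //.
by rewrite !mulf_eq0 !(gt_eqF abq, gt_eqF bcq, gt_eqF caq) /= !negb_and orbA in nz *.
Qed.

(** The diagonal [ac] cuts the quadrilateral into two triangles. Both contain [a] and [c], so a
    nonzero value at one of these suffices whichever triangle holds [q]. *)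
Lemma quadrilateral_pos a b c d p x q : 0 < orient a b c -> 0 < orient a c d ->
  polygon_interior (quadrilateral a b c d) q ->
  0 <= orient p x a -> 0 <= orient p x b -> 0 <= orient p x c -> 0 <= orient p x d ->
  (orient p x a != 0) || (orient p x c != 0) -> 0 < orient p x q.
Proof.
move=> abc acd /quadrilateral_interiorP[abq bcq cdq daq] pa pb pc pd nz.
have aux (s t u ya yc y0 : R) : 0 < s -> 0 < t -> 0 <= u -> 0 <= ya -> 0 <= yc -> 0 <= y0 ->
    (ya != 0) || (yc != 0) -> 0 < s * ya + t * yc + u * y0.
  move=> s0 t0 u0 ya0 yc0 y00 H; apply: ltr_wpDr; first exact: mulr_ge0.
  have h1 : 0 <= s * ya by apply: mulr_ge0 => //; exact: ltW.
  have h2 : 0 <= t * yc by apply: mulr_ge0 => //; exact: ltW.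
  rewrite lt_neqAle eq_sym addr_ge0 // andbT paddr_eq0 //.
  by rewrite !mulf_eq0 (gt_eqF s0) (gt_eqF t0) /= negb_and.
have [acq|acq] := leP (orient a c q) 0.
  rewrite -(pmulr_rgt0 _ abc) orient_barycentric addrAC; apply: aux => //.
  by rewrite orientC oppr_ge0.
rewrite -(pmulr_rgt0 _ acd) orient_barycentric; apply: aux => //; exact: ltW.
Qed.

End SmallPolygons.

(** * Placements as admissible families *)

Section Placements.
Variables (R : realType) (n : nat) (v : 'I_n.+1 -> R * R).
Hypothesis n2 : (2 <= n)%N.
Hypothesis v_convex : convex_polygon v.
Local Notation V := (vertex v).
Variable D : {set 'I_n.+1 * 'I_n.+1}.
Local Notation E := (chord D).

Section Diag.
Hypothesis D_diag : forall d, d \in D -> is_diagonal d.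
Let bd := chord_bound n2 D_diag.

(** Keeping the root out of the first alternative and the sides out of the second forces [w] to lie
    inside the polygon; constant signs then make its interior a single cell. *)
Lemma polygon_region k (w : 'I_k -> R * R) p : polygon_interior w p ->
  (forall q, cell v D p q -> polygon_interior w q) ->
  (forall c e, E c e ->
    ~ (c = 0%N /\ e = n) /\ (forall q, polygon_interior w q -> 0 < orient (V c) (V e) q) \/
    (c.+1 < e)%N /\ (forall q, polygon_interior w q -> orient (V c) (V e) q < 0)) ->
  is_region v D (polygon_interior w).
Proof.
move=> wp sub sgn.
have p_int : polygon_interior v p.
  apply/polygon_interiorP => //; split=> [i i_n|].
    by have [|[_ /(_ _ wp)//]|[]] := sgn i i.+1; [apply: Or31|lia].
  by have [|[[]]|[_ /(_ _ wp)]] := sgn 0%N n; [apply: Or32| |].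
have pD : diagonals_complement v D p.
  apply: complementP => // a b /sgn[[_ /(_ _ wp) h]|[_ /(_ _ wp) h]].
    by rewrite gt_eqF.
  by rewrite lt_eqF.
exists p => //; rewrite component_cell //; apply/seteqP; split=> // q wq a b.
case/sgn => [[_ h]|[_ h]]; first by rewrite mulr_gt0 ?h.
by rewrite nmulr_rgt0 ?h.
Qed.

Hypothesis E_laminar : forall a b c d, E a b -> E c d ->
  (a < c)%N -> (c < b)%N -> (b < d)%N -> False.

Lemma triangle_region a b c : E a b -> E b c -> E a c ->
  is_region v D (polygon_interior (triangle (V a) (V b) (V c))) /\
  convex_polygon (triangle (V a) (V b) (V c)).
Proof.
move=> ab bc ac; have abn := bd ab; have bcn := bd bc.
have abc : 0 < orient (V a) (V b) (V c) by apply: orient_pos => //; lia.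
split; last exact: triangle_convex.
pose p := 3^-1 *: (V a + V b + V c).
have pE x y : orient x y p = (orient x y (V a) + orient x y (V b) + orient x y (V c)) / 3.
  by rewrite /orient /p /= /GRing.scale /=; field.
have wp : polygon_interior (triangle (V a) (V b) (V c)) p.
  apply/triangle_interiorP; rewrite !pE !orient_l !orient_r !add0r !addr0 .
  have bca : 0 < orient (V b) (V c) (V a) by rewrite orient_rot.
  have cab : 0 < orient (V c) (V a) (V b) by rewrite orient_rot.
  by split; rewrite divr_gt0.
apply: (polygon_region wp) => [q pq|c0 e0 ce].
  move/triangle_interiorP: (wp) => [h1 h2 h3].
  have := pq _ _ ab; have := pq _ _ bc; have := pq _ _ ac.
  rewrite !(pmulr_rgt0 _ h1, pmulr_rgt0 _ h2) => h3' h2' h1'.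
  apply/triangle_interiorP; split=> //.
  rewrite orientC oppr_gt0; move: h3'; rewrite nmulr_rgt0 //.
  by rewrite orientC oppr_lt0.
have cen := bd ce.
have outside z : ~~ (c0 < z < e0)%N -> (z <= n)%N -> 0 <= orient (V c0) (V e0) (V z).
  by move=> ? ?; apply: orient_outside_ge0 => //; lia.
have inside z : (c0 <= z <= e0)%N -> 0 <= orient (V e0) (V c0) (V z).
  by move=> ?; rewrite orientC oppr_ge0; apply: orient_inside_le0 => //; lia.
(* Either no vertex of the triangle is strictly inside the chord, or by laminarity the chord spans
   all three. *)
case: (boolP [|| (c0 < a < e0), (c0 < b < e0) | (c0 < c < e0)]%N) => H; last first.
  left; split; first lia.
  move=> q wq; apply: (triangle_pos abc wq); try (apply: outside; lia).
  by rewrite !orient_eq0 //; lia.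
have H' : (c0 <= a /\ c <= e0)%N.
  have l1 := @E_laminar c0 e0 _ _ ce ab; have l2 := @E_laminar c0 e0 _ _ ce bc.
  have l3 := @E_laminar c0 e0 _ _ ce ac.
  have l1' := @E_laminar _ _ c0 e0 ab ce; have l2' := @E_laminar _ _ c0 e0 bc ce.
  have l3' := @E_laminar _ _ c0 e0 ac ce.
  by clear -abn bcn cen H l1 l2 l3 l1' l2' l3'; lia.
right; split; first lia.
move=> q wq; rewrite orientC oppr_lt0.
apply: (triangle_pos abc wq); try (apply: inside; lia).
by rewrite ![orient (V e0) _ _]orientC !oppr_eq0 !orient_eq0 //; lia.
Qed.

(** Without triangles neither [(a, c)] nor [(b, d)] is a chord, so nothing cuts the
    quadrilateral. *)
Lemma quadrilateral_region a b c d : (forall a b c, E a b -> E b c -> E a c -> False) ->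
  E a b -> E b c -> E c d -> E a d ->
  is_region v D (polygon_interior (quadrilateral (V a) (V b) (V c) (V d))) /\
  convex_polygon (quadrilateral (V a) (V b) (V c) (V d)).
Proof.
move=> notri ab bc cd ad; have abn := bd ab; have bcn := bd bc; have cdn := bd cd.
have abc : 0 < orient (V a) (V b) (V c) by apply: orient_pos => //; lia.
have abd : 0 < orient (V a) (V b) (V d) by apply: orient_pos => //; lia.
have acd : 0 < orient (V a) (V c) (V d) by apply: orient_pos => //; lia.
have bcd : 0 < orient (V b) (V c) (V d) by apply: orient_pos => //; lia.
split; last exact: quadrilateral_convex.
pose p := mid (V a) (V c).
have wp : polygon_interior (quadrilateral (V a) (V b) (V c) (V d)) p.
  apply/quadrilateral_interiorP; rewrite !orient_mid !orient_l !orient_r !add0r !addr0.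
  have bca : 0 < orient (V b) (V c) (V a) by rewrite orient_rot.
  have cda : 0 < orient (V c) (V d) (V a) by rewrite orient_rot.
  have dac : 0 < orient (V d) (V a) (V c) by rewrite -orient_rot.
  by split; rewrite divr_gt0.
apply: (polygon_region wp) => [q pq|c0 e0 ce].
  move/quadrilateral_interiorP: (wp) => [h1 h2 h3 h4].
  have := pq _ _ ab; have := pq _ _ bc; have := pq _ _ cd; have := pq _ _ ad.
  rewrite !(pmulr_rgt0 _ h1, pmulr_rgt0 _ h2, pmulr_rgt0 _ h3) => h4' h3' h2' h1'.
  apply/quadrilateral_interiorP; split=> //.
  rewrite orientC oppr_gt0; move: h4'; rewrite nmulr_rgt0 //.
  by rewrite orientC oppr_lt0.
have cen := bd ce.
have nac : ~ (c0 = a /\ e0 = c) by case=> h1 h2; subst; apply: (notri a b c).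
have outside z : ~~ (c0 < z < e0)%N -> (z <= n)%N -> 0 <= orient (V c0) (V e0) (V z).
  by move=> ? ?; apply: orient_outside_ge0 => //; lia.
have inside z : (c0 <= z <= e0)%N -> 0 <= orient (V e0) (V c0) (V z).
  by move=> ?; rewrite orientC oppr_ge0; apply: orient_inside_le0 => //; lia.
case: (boolP [|| (c0 < a < e0), (c0 < b < e0), (c0 < c < e0) | (c0 < d < e0)]%N) => H; last first.
  left; split; first lia.
  move=> q wq; apply: (quadrilateral_pos abc acd wq); try (apply: outside; lia).
  by rewrite !orient_eq0 //; lia.
have nbd : ~ (c0 = b /\ e0 = d) by case=> h1 h2; subst; apply: (notri b c d).
have H' : (c0 <= a /\ d <= e0)%N.
  have l1 := @E_laminar c0 e0 _ _ ce ab; have l2 := @E_laminar c0 e0 _ _ ce bc.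
  have l3 := @E_laminar c0 e0 _ _ ce cd; have l4 := @E_laminar c0 e0 _ _ ce ad.
  have l1' := @E_laminar _ _ c0 e0 ab ce; have l2' := @E_laminar _ _ c0 e0 bc ce.
  have l3' := @E_laminar _ _ c0 e0 cd ce; have l4' := @E_laminar _ _ c0 e0 ad ce.
  by clear -abn bcn cdn cen H nac nbd l1 l2 l3 l4 l1' l2' l3' l4'; lia.
right; split; first lia.
move=> q wq; rewrite orientC oppr_lt0.
apply: (quadrilateral_pos abc acd wq); try (apply: inside; lia).
by rewrite ![orient (V e0) _ _]orientC !oppr_eq0 !orient_eq0 //; lia.
Qed.

End Diag.

Lemma placement_admissible : 
  noncrossing_diagonals v D /\ no_triangle_quadrilateral v D <->
  (forall d, d \in D -> is_diagonal d) /\ admissible n E.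
Proof.
split=> [[[dg nc] ntq]|[dg G]].
  split=> //; have bd := chord_bound n2 dg.
  have lam a b c d : E a b -> E c d -> (a < c)%N -> (c < b)%N -> (b < d)%N -> False.
    move=> ab cd ac cb bd'; have cdn := bd _ _ cd.
    case: ab => [[e _]|[e1 e2]|[x xD [xa xb]]]; [lia|lia|].
    case: cd => [[e _]|[e1 e2]|[y yD [yc yd]]]; [lia|lia|].
    have xy : x != y by apply/eqP => e; subst y; lia.
    by apply: (crossing n2 v_convex (dg _ xD) (dg _ yD)) (nc _ _ xD yD xy);
      rewrite -?xa -?xb -?yc -?yd ?ac ?cb.
  have tri a b c : E a b -> E b c -> E a c -> False.
    move=> ab bc ac; have [reg cvx] := triangle_region dg lam ab bc ac.
    by have [] := ntq _ reg; case; exists (triangle (V a) (V b) (V c)).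
  split=> //.
  - by move=> a an; apply: Or31.
  - exact: Or32.
  - move=> a b c d ab bc cd ad; have [reg cvx] := quadrilateral_region dg lam tri ab bc cd ad.
    by have [_] := ntq _ reg; case; exists (quadrilateral (V a) (V b) (V c) (V d)).
split.
  split=> // d e dD eD de.
  have Ed : E d.1 d.2 by apply: Or33; exists d.
  have Ee : E e.1 e.2 by apply: Or33; exists e.
  apply: uncrossed => //; [exact: dg|exact: dg| |]; apply/negP => /andP[/andP[h1 h2] h3].
    exact: (admissible_laminar G Ed Ee).
  exact: (admissible_laminar G Ee Ed).
move=> A [p pD ->]; rewrite (component_cell n2 v_convex dg pD).
by split=> -[w _]; apply: (cell_not_small n2 v_convex dg G pD).
Qed.

End Placements.

(** * Intervals and chords *)

Definition chord_intervals n (D : {set 'I_n.+1 * 'I_n.+1}) : {set {set 'I_n}} :=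
  [set A : {set 'I_n} | `[< exists a b, chord D a b /\ A = value_range n a b >]]%SET.

Lemma mem_chord_intervals n (D : {set 'I_n.+1 * 'I_n.+1}) a b : (2 <= n)%N ->
  (forall d, d \in D -> is_diagonal d) -> (a < b <= n)%N ->
  value_range n a b \in chord_intervals D <-> chord D a b.
Proof.
move=> n2 dg abn; rewrite inE; split=> [/asboolP[c [d [cd]]]|ab].
  by move=> /(value_range_inj abn (chord_bound n2 dg cd))[-> ->].
by apply/asboolP; exists a, b.
Qed.

(** A diagonal is neither a side nor the root, so it is recovered from its range of values. *)
Lemma chord_intervals_inj n (D D' : {set 'I_n.+1 * 'I_n.+1}) : (2 <= n)%N ->
  (forall d, d \in D -> is_diagonal d) -> (forall d, d \in D' -> is_diagonal d) ->
  chord_intervals D = chord_intervals D' -> D = D'.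
Proof.
move=> n2; wlog suff sub : D D' / (forall d, d \in D -> is_diagonal d) ->
  (forall d, d \in D' -> is_diagonal d) -> chord_intervals D = chord_intervals D' ->
  D \subset D'.
  by move=> dg dg' e; apply/eqP; rewrite finset.eqEsubset !sub.
move=> dg dg' e; apply/fintype.subsetP => d dD.
have dE : chord D d.1 d.2 by apply: Or33; exists d.
have bd := chord_bound n2 dg dE.
have : chord D' d.1 d.2 by rewrite -mem_chord_intervals // -e mem_chord_intervals.
have /is_diagonalP[h1 h2] := dg _ dD.
case=> [[e1 _]|//|[d' dD' [e1 e2]]]; first by rewrite e1 ltnn in h1.
suff -> : d = d' by [].
by apply: injective_projections; apply: val_inj.
Qed.

Lemma blockwise_simple_chords n (pi : 'S_n) : (2 <= n)%N -> blockwise_simple pi ->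
  exists D : {set 'I_n.+1 * 'I_n.+1}, [/\ forall d, d \in D -> is_diagonal d,
    admissible n (chord D) & interval_poset pi = chord_intervals D].
Proof.
move=> n2 /blockwise_simple_admissible G.
pose D := [set d : 'I_n.+1 * 'I_n.+1 | is_diagonal d && `[< value_interval pi d.1 d.2 >]]%SET.
have DE : chord D = value_interval pi.
  apply/funext => a; apply/funext => b; apply/propext; split.
    case=> [[-> an]|[-> ->]|[d + [-> ->]]].
    - exact: value_interval_single.
    - by apply: value_interval_whole; lia.
    by rewrite inE => /andP[_ /asboolP].
  move=> ab; have abn := admissible_bound G ab.
  have [->|ba] := eqVneq b a.+1; first by apply: Or31; lia.
  have [[-> ->]|ab0n] := pselect (a = 0%N /\ b = n); first exact: Or32.
  have aK : (inord a : 'I_n.+1) = a :> nat by rewrite inordK //; lia.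
  have bK : (inord b : 'I_n.+1) = b :> nat by rewrite inordK //; lia.
  apply: Or33; exists (inord a, inord b); rewrite /= ?aK ?bK //.
  rewrite inE /= aK bK.
  apply/andP; split; last exact/asboolP.
  by apply/is_diagonalP; rewrite /= aK bK; lia.
exists D; split; first by move=> d; rewrite inE => /andP[].
  by rewrite DE.
apply/setP => A; rewrite !inE DE; apply/idP/asboolP => [/perm_intervalP //|].
by move=> ?; apply/perm_intervalP.
Qed.

Theorem theorem4p6 (R : realType) (n : nat) (n_ge2 : (2 <= n)%N)
    (v : 'I_n.+1 -> R * R) (v_convex : convex_polygon v) :
  #|blockwise_simple_posets n| = #|diagonal_placements v|.
Proof.
have placeP D : D \in diagonal_placements v <->
    (forall d, d \in D -> is_diagonal d) /\ admissible n (chord D).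
  rewrite inE -(placement_admissible n_ge2 v_convex D).
  by split=> [/asboolP|?]; last exact/asboolP.
(* The posets are the image of the placements, so that injectivity gives the equality of the
   cardinals. *)
have -> : blockwise_simple_posets n = [set chord_intervals D | D in diagonal_placements v]%SET.
  apply/setP => P; rewrite inE; apply/asboolP/imsetP.
    case=> pi /(blockwise_simple_chords n_ge2)[D [dg G e]] ->.
    by exists D => //; apply/placeP.
  case=> D /placeP[dg G] ->; have [|pi piS piE] := admissible_realized _ G; first lia.
  exists pi => //; apply/setP => A; rewrite !inE; apply/asboolP/idP.
    by case=> a [b [ab ->]]; apply/perm_intervalP; exists a, b; rewrite piE.
  by move/perm_intervalP => [a [b [ab ->]]]; exists a, b; rewrite -piE.
apply: card_in_imset => D D' /placeP[dg _] /placeP[dg' _].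
exact: chord_intervals_inj.
Qed.
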